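(* Let $\mathsf{k}$ be an algebraically closed field, let $A$ be a local finite-dimensional $\mathsf{k}$-algebra, and let $G$ be a finite group acting on $A$ by $\mathsf{k}$-algebra automorphisms, with $\operatorname{char}\mathsf{k}\nmid|G|$. Then $$\mathsf{FPdim}(A\ast G)\ge\mathsf{FPdim}(A).$$
   Context: For a finite group $G$ acting on $A$ by $\mathsf{k}$-algebra automorphisms, $A\ast G$ is the skew group algebra: the free $A$-module on the basis $G$ with multiplication determined by $ga=g(a)g$ for $g\in G$, $a\in A$, and the multiplications of $A$ and $G$. $\mathsf{k}$ is an algebraically closed field. An algebra means a finite-dimensional $\mathsf{k}$-algebra, not assumed connected; modules are finitely generated right modules, and $\mathsf{mod}\,A$ is the category of such $A$-modules. A module $S$ is a brick if $\mathrm{End}_A(S)$ is a division ring (equivalently $\mathrm{End}_A(S)\simeq\mathsf{k}$). A semibrick is a (possibly empty) set $\mathcal S$ of pairwise non-isomorphic bricks with $\mathrm{Hom}_A(S,S')=0$ for all non-isomorphic $S,S'\in\mathcal S$. For a finite semibrick $\mathcal S$, the $\mathrm{Ext}$-quiver $Q_{\mathcal S}$ has vertex set $\mathcal S$ and exactly $\dim_{\mathsf k}\mathrm{Ext}^1_A(S,S')$ arrows from $S$ to $S'$ (loops included). For a quiver $Q$, $\rho(Q)$ is the spectral radius (largest modulus of an eigenvalue) of its adjacency matrix, with $\rho=0$ for the empty quiver. The Frobenius--Perron dimension of $A$ is $\mathsf{FPdim}(A)=\sup\{\rho(Q_{\mathcal S})\mid \mathcal S \text{ a finite semibrick in } \mathsf{mod}\,A\}\in[0,\infty]$.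 *)

(* Defs.v *)
From HB Require Import structures.
From mathcomp Require Import all_boot all_order all_algebra all_fingroup all_field.
From mathcomp Require Import complex.
From mathcomp Require Import all_classical all_reals ereal.

Set Implicit Arguments.
Unset Strict Implicit.
Unset Printing Implicit Defensive.

Import GRing.Theory Num.Theory.
Local Open Scope ring_scope.

(* Over a finite-dimensional algebra the finitely generated modules are the
   finite-dimensional ones; [rmod_act v a] is the product v a. *)
Record rmodule (k : fieldType) (B : falgType k) := RModule {
  rmod_sort :> vectType k;
  rmod_act : rmod_sort -> B -> rmod_sort;
  rmod_act_linearl : forall a, linear (rmod_act ^~ a);
  rmod_act_linearr : forall v, linear (rmod_act v);
  rmod_act1 : forall v, rmod_act v 1 = v;
  rmod_actM : forall v a b, rmod_act v (a * b) = rmod_act (rmod_act v a) b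
}.

Section Modules.
Variables (k : fieldType) (B : falgType k).
Implicit Types (M N P : rmodule B) (a b : B).

Definition rmod_actl M a (v : M) : M := rmod_act v a.

HB.instance Definition _ M (v : M) :=
  GRing.isLinear.Build k B M _ (rmod_act v) (rmod_act_linearr v).
HB.instance Definition _ M a :=
  GRing.isLinear.Build k M M _ (@rmod_actl M a) (@rmod_act_linearl k B M a).

Definition is_rhom M N (f : 'Hom(M, N)) : Prop :=
  forall (v : M) a, f (rmod_act v a) = rmod_act (f v) a.

Definition rhom_defect M N a (f : 'Hom(M, N)) : 'Hom(M, N) :=
  ((f \o linfun (@rmod_actl M a)) - (linfun (@rmod_actl N a) \o f))%VF.

Fact rhom_defectE M N a (f : 'Hom(M, N)) v :
  rhom_defect a f v = f (rmod_act v a) - rmod_act (f v) a.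
Proof. by rewrite /rhom_defect add_lfunE opp_lfunE !comp_lfunE !lfunE. Qed.

Fact rhom_defect_linear M N a : linear (@rhom_defect M N a).
Proof.
move=> c f g; rewrite /rhom_defect comp_lfunDl comp_lfunDr -comp_lfunZl.
by rewrite -comp_lfunZr scalerBr opprD addrACA.
Qed.

HB.instance Definition _ M N a :=
  GRing.isLinear.Build k 'Hom(M, N) 'Hom(M, N) _ (@rhom_defect M N a)
    (@rhom_defect_linear M N a).

(* Hom_B(M, N) as a subspace of Hom_k(M, N); commutation is imposed on a basis
   of B only, which suffices by rHomP. *)
Definition rHom M N : {vspace 'Hom(M, N)} :=
  (\bigcap_(i < \dim {:B}) lker (linfun (@rhom_defect M N (vbasis {:B})`_i)))%VS.

Lemma rHomP M N (f : 'Hom(M, N)) : f \in rHom M N <-> is_rhom f.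
Proof.
split=> [| fH]; last first.
  rewrite memvE; apply/subv_bigcapP => i _; rewrite -memvE memv_ker lfunE /=.
  by apply/eqP/lfunP => v; rewrite rhom_defectE fH subrr lfunE.
rewrite memvE => /subv_bigcapP fH v a.
rewrite (coord_vbasis (memvf a)) !linear_sum /=; apply: eq_bigr => i _.
have := fH i isT; rewrite -memvE memv_ker lfunE /= => /eqP/lfunP/(_ v).
rewrite rhom_defectE lfunE /= => /eqP; rewrite subr_eq0 => /eqP fE.
by rewrite !linearZ /= fE.
Qed.

Definition rmod_iso M N : Prop :=
  exists f g, [/\ f \in rHom M N, g \in rHom N M,
                  (g \o f)%VF = \1%VF & (f \o g)%VF = \1%VF].

(* [End_B(M)] is a division ring; the first clause says that it is nonzero. *)
Definition brick M : Prop :=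
  (\1%VF : 'End(M)) != 0 /\
  forall f, f \in rHom M M -> f != 0 ->
    exists2 g, g \in rHom M M & (g \o f)%VF = \1%VF /\ (f \o g)%VF = \1%VF.

(* A finite set of pairwise non-isomorphic modules is listed without repetition
   by an index set 'I_n; n = 0 gives the empty semibrick. *)
Definition semibrick n (S : 'I_n -> rmodule B) : Prop :=
  [/\ forall i, brick (S i),
      forall i j, i != j -> ~ rmod_iso (S i) (S j) &
      forall i j, i != j -> rHom (S i) (S j) = 0%VS].

Section FreeModule.
Variable n : nat.

Definition rfree_act (u : {ffun 'I_n -> B}) a : {ffun 'I_n -> B} :=
  [ffun i => u i * a].

Fact rfree_act_linearl a : linear (rfree_act ^~ a).
Proof. by move=> c u v; apply/ffunP => i; rewrite !ffunE mulrDl scalerAl. Qed.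
Fact rfree_act_linearr u : linear (rfree_act u).
Proof. by move=> c a b; apply/ffunP => i; rewrite !ffunE mulrDr scalerAr. Qed.
Fact rfree_act1 u : rfree_act u 1 = u.
Proof. by apply/ffunP => i; rewrite !ffunE mulr1. Qed.
Fact rfree_actM u a b : rfree_act u (a * b) = rfree_act (rfree_act u a) b.
Proof. by apply/ffunP => i; rewrite !ffunE mulrA. Qed.

Definition rfree : rmodule B :=
  RModule rfree_act_linearl rfree_act_linearr rfree_act1 rfree_actM.

Definition rfree_map_fun M (X : n.-tuple M) (u : {ffun 'I_n -> B}) : M :=
  \sum_(i < n) rmod_act (tnth X i) (u i).

Fact rfree_map_linear M (X : n.-tuple M) : linear (rfree_map_fun X).
Proof.
move=> c u v; rewrite /rfree_map_fun scaler_sumr -big_split /=.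
by apply: eq_bigr => i _; rewrite !ffunE linearP.
Qed.

HB.instance Definition _ M (X : n.-tuple M) :=
  GRing.isLinear.Build k {ffun 'I_n -> B} M _ (rfree_map_fun X)
    (rfree_map_linear X).

(* The homomorphism B^n -> M sending the i-th basis element to X_i. *)
Definition rfree_map M (X : n.-tuple M) : 'Hom(rfree, M) :=
  linfun (rfree_map_fun X : rfree -> M).

Lemma rfree_map_rhom M (X : n.-tuple M) : rfree_map X \in rHom rfree M.
Proof.
apply/rHomP => u a; rewrite !lfunE /= /rfree_map_fun.
rewrite -[RHS]/(rmod_actl a _) linear_sum /=.
by apply: eq_bigr => i _; rewrite ffunE rmod_actM.
Qed.

End FreeModule.

Definition vbasis_map M (U : {vspace M}) : 'Hom(rfree (\dim U), M) :=
  rfree_map (vbasis U).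

Lemma vbasis_map_rhom M (U : {vspace M}) :
  vbasis_map U \in rHom (rfree (\dim U)) M.
Proof. exact: rfree_map_rhom. Qed.

Lemma limg_vbasis_map M (U : {vspace M}) :
  (forall v a, v \in U -> rmod_act v a \in U) -> limg (vbasis_map U) = U.
Proof.
move=> UB; apply/eqP; rewrite eqEsubv; apply/andP; split; apply/subvP => v.
  case/memv_imgP => u _ ->; rewrite lfunE /=; apply: memv_suml => i _.
  by apply: UB; apply: vbasis_mem; apply: mem_tnth.
move=> vU; apply/memv_imgP.
exists [ffun i => (coord (vbasis U) i v)%:A]; first exact: memvf.
rewrite lfunE /= /rfree_map_fun {1}(coord_vbasis vU); apply: eq_bigr => i _.
by rewrite ffunE linearZ /= rmod_act1 (tnth_nth 0).
Qed.

Lemma rker_stable M N (f : 'Hom(M, N)) v a :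
  f \in rHom M N -> v \in lker f -> rmod_act v a \in lker f.
Proof.
move=> /rHomP fH; rewrite !memv_ker fH => /eqP ->.
by rewrite -[rmod_act _ _]/(rmod_actl a 0) linear0.
Qed.

(* The start F_2 -> F_1 -> F_0 -> M -> 0 of a free resolution of M. *)
Definition res_F0 M : rmodule B := rfree (\dim {:M}).
Definition res_d0 M : 'Hom(res_F0 M, M) := vbasis_map {:M}.
Definition res_F1 M : rmodule B := rfree (\dim (lker (res_d0 M))).
Definition res_d1 M : 'Hom(res_F1 M, res_F0 M) := vbasis_map (lker (res_d0 M)).
Definition res_F2 M : rmodule B := rfree (\dim (lker (res_d1 M))).
Definition res_d2 M : 'Hom(res_F2 M, res_F1 M) := vbasis_map (lker (res_d1 M)).

Lemma res_exact M : [/\ limg (res_d0 M) = fullv,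
  limg (res_d1 M) = lker (res_d0 M) & limg (res_d2 M) = lker (res_d1 M)].
Proof.
split; apply: limg_vbasis_map => v a; first by rewrite !memvf.
  exact: rker_stable (vbasis_map_rhom _).
exact: rker_stable (vbasis_map_rhom _).
Qed.

Definition precomp (U V W : vectType k) (d : 'Hom(U, V)) (f : 'Hom(V, W)) :
  'Hom(U, W) := (f \o d)%VF.

Fact precomp_linear (U V W : vectType k) (d : 'Hom(U, V)) : linear (@precomp U V W d).
Proof. by move=> c f g; rewrite /precomp comp_lfunDl comp_lfunZl. Qed.

HB.instance Definition _ (U V W : vectType k) (d : 'Hom(U, V)) :=
  GRing.isLinear.Build k 'Hom(V, W) 'Hom(U, W) _ (@precomp U V W d)
    (@precomp_linear U V W d).

Definition ext1_cocycles M N : {vspace 'Hom(res_F1 M, N)} :=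
  (rHom (res_F1 M) N :&: lker (linfun (@precomp _ _ N (res_d2 M))))%VS.
Definition ext1_coboundaries M N : {vspace 'Hom(res_F1 M, N)} :=
  (linfun (@precomp _ _ N (res_d1 M)) @: rHom (res_F0 M) N)%VS.

Lemma ext1_coboundaries_sub M N :
  (ext1_coboundaries M N <= ext1_cocycles M N)%VS.
Proof.
apply/subvP => _ /memv_imgP[f /rHomP fH ->].
have /rHomP d1H : res_d1 M \in rHom (res_F1 M) (res_F0 M).
  exact: vbasis_map_rhom.
have -> : linfun (@precomp _ _ N (res_d1 M)) f = (f \o res_d1 M)%VF.
  by rewrite lfunE.
rewrite memv_cap; apply/andP; split.
  by apply/rHomP => v a; rewrite !comp_lfunE d1H fH.
rewrite memv_ker lfunE; apply/eqP/lfunP => v.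
rewrite /= /precomp !comp_lfunE lfunE /=.
suff /eqP -> : res_d1 M (res_d2 M v) == 0 by rewrite linear0.
by rewrite -memv_ker; case: (res_exact M) => _ _ <-; rewrite memv_img ?memvf.
Qed.

(* dim_k Ext^1_B(M, N), where Ext^1_B(M, N) = H^1(Hom_B(F_*, N)). *)
Definition dim_ext1 M N : nat :=
  (\dim (ext1_cocycles M N) - \dim (ext1_coboundaries M N))%N.

(* The Ext-quiver of S, given by its adjacency matrix: the (i, j) entry is the
   number of arrows from S i to S j. *)
Definition ext_quiver n (S : 'I_n -> rmodule B) : 'M[nat]_n :=
  \matrix_(i, j) dim_ext1 (S i) (S j).

End Modules.

(* As sup set0 = 0 in a realType, the spectral radius of the 0 x 0 matrix is 0;
   otherwise the set below is finite and nonempty. *)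
Definition spectral_radius (R : realType) n (Q : 'M[nat]_n) : R :=
  sup [set Normc.normc z | z in
        [set z : R[i] | eigenvalue (map_mx (fun m => m%:R : R[i]) Q) z]]%classic.

Definition FPdim (R : realType) (k : fieldType) (B : falgType k) : \bar R :=
  ereal_sup [set x : \bar R | exists n (S : 'I_n -> rmodule B),
    semibrick S /\ x = (spectral_radius R (ext_quiver S))%:E]%classic.

Section Local.
Variables (k : fieldType) (A : falgType k).
Implicit Types I J : {vspace A}.

(* Right ideals of a k-algebra are automatically k-subspaces. *)
Definition right_ideal I : Prop := forall x a : A, x \in I -> x * a \in I.

Definition maximal_right_ideal I : Prop :=
  [/\ right_ideal I, I <> fullv &
      forall J, right_ideal J -> (I <= J)%VS -> J = I \/ J = fullv].

Definition local_algebra : Prop := exists! I, maximal_right_ideal I.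

End Local.

Record algAction (k : fieldType) (A : falgType k) (G : finGroupType) :=
  AlgAction {
    alg_act :> G -> {lrmorphism A -> A};
    alg_act1 : forall a, alg_act 1%g a = a;
    alg_actM : forall g h a, alg_act (g * h)%g a = alg_act g (alg_act h a)
  }.

(* u : skew_group act stands for the sum of the (u g) g over g in G. The ring
   structure installed below is not the pointwise one on {ffun G -> A}. *)
Definition skew_group (k : fieldType) (A : falgType k) (G : finGroupType)
  (act : algAction A G) : Type := {ffun G -> A}.

Section SkewGroup.
Variables (k : fieldType) (A : falgType k) (G : finGroupType).
Variable act : algAction A G.
Notation AG := (skew_group act).
Implicit Types (u v w : AG) (a b : A) (g h x : G).

HB.instance Definition _ := Vector.copy AG {ffun G -> A}.

Definition skew_elt a g : AG := [ffun x => if x == g then a else 0].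

Definition skew_one : AG := skew_elt 1 1%g.

(* (a g) (b h) = a g(b) gh, collected by the group element x = gh. *)
Definition skew_mul u v : AG :=
  [ffun x => \sum_(g : G) (u : {ffun G -> A}) g *
                          act g ((v : {ffun G -> A}) (g^-1 * x)%g)].

Fact skew_mulA : associative skew_mul.
Proof.
move=> u v w; apply/ffunP => x; rewrite !ffunE.
under eq_bigr => g _.
  rewrite ffunE rmorph_sum /= mulr_sumr (reindex_inj (mulgI g^-1%g)) /=.
  over.
rewrite exchange_big /=; apply: eq_bigr => g _.
rewrite ffunE mulr_suml; apply: eq_bigr => h _.
by rewrite rmorphM /= mulrA -alg_actM mulKVg invMg invgK -mulgA mulKVg.
Qed.

Fact skew_mul1 : left_id skew_one skew_mul.
Proof.
move=> u; apply/ffunP => x; rewrite ffunE (bigD1 1%g) //= big1 ?addr0.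
  by rewrite ffunE eqxx mul1r invg1 mul1g alg_act1.
by move=> g /negPf gn1; rewrite ffunE gn1 mul0r.
Qed.

Fact skew_mulr1 : right_id skew_one skew_mul.
Proof.
move=> u; apply/ffunP => x; rewrite ffunE (bigD1 x) //= big1 ?addr0.
  by rewrite ffunE mulVg eqxx rmorph1 mulr1.
move=> g gnx; rewrite ffunE -eq_mulVg1 (negPf gnx) rmorph0.
by rewrite mulr0.
Qed.

Fact skew_mulDl : left_distributive skew_mul +%R.
Proof.
move=> u v w; apply/ffunP => x; rewrite !ffunE -big_split /=.
by apply: eq_bigr => g _; rewrite ffunE mulrDl.
Qed.

Fact skew_mulDr : right_distributive skew_mul +%R.
Proof.
move=> u v w; apply/ffunP => x; rewrite !ffunE -big_split /=.
by apply: eq_bigr => g _; rewrite ffunE rmorphD mulrDr.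
Qed.

Fact skew_one_neq0 : skew_one != 0.
Proof.
apply/eqP => /ffunP/(_ 1%g)/eqP; rewrite !ffunE eqxx.
by rewrite oner_eq0.
Qed.

HB.instance Definition _ := GRing.Zmodule_isNzRing.Build AG
  skew_mulA skew_mul1 skew_mulr1 skew_mulDl skew_mulDr skew_one_neq0.

Fact skew_scaleAl (c : k) u v : c *: (u * v) = (c *: u) * v.
Proof.
apply/ffunP => x; rewrite !ffunE scaler_sumr.
by apply: eq_bigr => g _; rewrite ffunE scalerAl.
Qed.

HB.instance Definition _ := GRing.Lmodule_isLalgebra.Build k AG skew_scaleAl.

Fact skew_scaleAr (c : k) u v : c *: (u * v) = u * (c *: v).
Proof.
apply/ffunP => x; rewrite !ffunE scaler_sumr.
by apply: eq_bigr => g _; rewrite ffunE linearZ scalerAr.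
Qed.

HB.instance Definition _ := GRing.Lalgebra_isAlgebra.Build k AG skew_scaleAr.
HB.instance Definition _ := Algebra_isFalgebra.Build k AG.

Lemma skew_eltM a b g h :
  skew_elt a g * skew_elt b h = skew_elt (a * act g b) (g * h)%g.
Proof.
apply/ffunP => x; rewrite ffunE (bigD1 g) //= big1 ?addr0 => [|g' ng'].
  rewrite !ffunE eqxx -(can2_eq (mulKVg g) (mulKg g)).
  by case: eqP => // _; rewrite rmorph0 mulr0.
by rewrite ffunE (negPf ng') mul0r.
Qed.

End SkewGroup.

(* Main.v *)
Require Import Defs.
From HB Require Import structures.
From mathcomp Require Import all_boot all_order all_algebra all_fingroup all_field.
From mathcomp Require Import all_solvable mxrepresentation complex.
From mathcomp Require Import all_classical all_reals ereal.

(* Write A = k + I with I the radical, let eps : A -> k be the augmentation and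
   let d be the dimension of the space of eps-derivations A -> k, that is, of
   Ext^1_A(k, k). As k is the only brick of A, FPdim A = d.

   The semibrick of A * G consists of the irreducible representations S_i of G,
   of degree n_i, on which A acts through eps. Restriction of A * G-modules to
   A satisfies sum_j n_j dim Hom(X, S_j) = dim Hom_A(X, k), because the S_j with
   multiplicities n_j make up the module coinduced from k. Free A * G-modules
   being free over A, this gives
     sum_j n_j dim Ext^1(S_i, S_j) = dim Ext^1_A(S_i, k) = n_i d,
   so d is an eigenvalue of the Ext-quiver of (S_i). *)

Set Implicit Arguments.
Unset Strict Implicit.
Unset Printing Implicit Defensive.

Import Order.TTheory GRing.Theory Num.Theory VectorInternalTheory.
Local Open Scope ring_scope.

(** * Matrix units of a semisimple group algebra *)

(** The coinduced module is never constructed. As |G| is invertible in k, the group algebra has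
    matrix units, and evaluating functionals at them splits Hom_A(X, k) by hand into blocks, the
    i-th of which amounts to n_i copies of Hom(X, S_i). Ext over A of a restricted module is not
    formed either: a short exact sequence K -> F -> M turns Ext into dimensions of Hom, and these
    restrict well. The S_i are modules over A * G only because eps is G-invariant. This comes from
    locality: eps a is the only scalar c for which a - c is not a unit, and automorphisms preserve
    units. *)

Lemma mul_mx_delta_mx (K : comPzRingType) m n p q (A : 'M[K]_(m, n))
    (B : 'M[K]_(p, q)) s t i j : (A *m delta_mx s t *m B) i j = A i s * B t j.
Proof.
rewrite -(mul_delta_mx (0 : 'I_1)) mulmxA -colE -mulmxA -rowE mxE big_ord1.
by rewrite !mxE.
Qed.

Lemma mxtrace_delta_mx (K : pzRingType) n (s t : 'I_n) :
  \tr (delta_mx s t : 'M[K]_n) = (s == t)%:R.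
Proof.
rewrite /mxtrace (bigD1 s) //= big1 ?addr0 => [|i /negPf si]; rewrite mxE.
  by rewrite eqxx.
by rewrite si.
Qed.

Section MatrixUnits.
Variables (k : closedFieldType) (G : finGroupType).
Hypothesis charG : forall p : nat, p \in [pchar k] -> ~~ (p %| #|G|)%N.

Lemma card_group_neq0 : #|G|%:R != 0 :> k.
Proof.
apply/negP => G0.
have [|p pk] := natf0_pchar _ G0; first by apply/card_gt0P; exists 1%g.
by have := charG pk; rewrite (dvdn_pcharf pk) G0.
Qed.

Lemma pchar_pgroup : pgroup [pchar k]^' [set: G].
Proof.
rewrite /pgroup cardsT; apply/pnatP => [|p p_pr pG].
  by apply/card_gt0P; exists 1%g.
by apply/negP => /charG; rewrite pG.
Qed.

Lemma mxtrace_regular_mx (g : G) :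
  \tr (regular_repr k [set: G] g) = (#|G| * (g == 1%g))%:R.
Proof.
rewrite /mxtrace; case: eqP => [-> | /eqP g1].
  rewrite repr_mx1.
  under eq_bigr do rewrite mxE eqxx.
  by rewrite sumr_const card_ord [gcard _]cardsT muln1.
rewrite muln0 big1 // => i _; rewrite /= !mxE eqxx /=.
case: eqP => // ii; case/eqP: g1; apply: (@mulgI _ (enum_val i)).
by rewrite mulg1 {2}ii gring_indexK ?inE.
Qed.

(** Averaging over G turns any matrix into an intertwiner: substitute g -> g h^-1 in the sum. *)
Lemma mxsum_intertwiner n1 n2 (rG1 : mx_representation k [set: G] n1)
    (rG2 : mx_representation k [set: G] n2) (X : 'M[k]_(n1, n2)) (h : G) :
  rG1 h *m (\sum_g rG1 g^-1%g *m X *m rG2 g) =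
  (\sum_g rG1 g^-1%g *m X *m rG2 g) *m rG2 h.
Proof.
rewrite mulmx_sumr mulmx_suml [RHS](reindex_inj (mulIg h^-1%g)) /=.
apply: eq_bigr => g _; rewrite -!mulmxA -repr_mxM ?inE // mulgKV.
by rewrite !mulmxA -repr_mxM ?inE // invMg invgK.
Qed.

Variable sG : irrType k [set: G].

Notation rho := (@irr_repr k G [set: G]%G sG).

(** The Wedderburn idempotent of block i acts as 1 in [rho i] and as 0 in [rho j]; moving it through
    [f] gives f = 0. *)
Lemma irr_intertwiner0 (i j : sG) (f : 'M[k]_(irr_degree i, irr_degree j)) :
  i != j -> (forall g, rho i g *m f = f *m rho j g) -> f = 0.
Proof.
move=> nij fG; set e := Wedderburn_id i.
have /envelop_mxP[a ea] : (e \in group_ring k [set: G])%MS.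
  rewrite -(Wedderburn_sum_pchar sG pchar_pgroup).
  by apply: sumsmx_sup (Wedderburn_id_mem i).
have opE l : gring_op (rho l) e = \sum_(g in [set: G]) a g *: rho l g.
  rewrite ea linear_sum /=; apply: eq_bigr => g Gg.
  by rewrite linearZ /= gring_opG.
rewrite -[f]mul1mx -(op_Wedderburn_id_pchar pchar_pgroup) opE mulmx_suml.
under eq_bigr do rewrite -scalemxAl fG scalemxAr.
rewrite -mulmx_sumr -opE.
by rewrite (irr_repr'_op0_pchar pchar_pgroup _ (Wedderburn_id_mem i)) ?mulmx0.
Qed.

Lemma irr_centralizer_scalar (i : sG) (f : 'M[k]_(irr_degree i)) :
  (forall g, rho i g *m f = f *m rho i g) -> exists c, f = c%:M.
Proof.
move=> fG; apply/is_scalar_mxP.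
apply: (mx_abs_irr_cent_scalar (rG := rho i)).
  exact: (@group_closure_closed_field k G [set: G]%G) (socle_irr i).
by apply/centgmxP => g _; rewrite fG.
Qed.

(** Fourier inversion: this is the coefficient at [g] of the element of k[G] that acts as the matrix
    unit (s, r) in block i and as 0 in every other block. *)
Definition irr_unit (i : sG) (s r : 'I_(irr_degree i)) (g : G) : k :=
  (irr_degree i)%:R / #|G|%:R * rho i g^-1%g r s.


(* Schur orthogonality: the sum of the [rho g^-1 *m delta_mx s p *m rho g] is
   scalar, and its trace is [#|G| * (s == p)]. *)
Lemma irr_unit_irr (i : sG) (s r : 'I_(irr_degree i)) :
  \sum_g irr_unit s r g *: rho i g = delta_mx s r.
Proof.
apply/matrixP => p q; rewrite summxE !mxE.
have [y yE] := irr_centralizer_scalar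
  (mxsum_intertwiner (rho _) (rho _) (delta_mx s p)).
have trE : (irr_degree i)%:R * y = #|G|%:R * (s == p)%:R.
  rewrite mulr_natl -mxtrace_scalar -yE.
  rewrite raddf_sum /=.
  under eq_bigr => g _.
    rewrite mxtrace_mulC mulmxA -repr_mxM ?inE // mulgV repr_mx1 mul1mx.
    rewrite mxtrace_delta_mx.
    over.
  by rewrite sumr_const mulr_natl.
have := congr1 (fun M : 'M_(irr_degree i) => M r q) yE.
rewrite summxE mxE => yrq.
have -> : \sum_g (irr_unit s r g *: rho i g) p q =
    (irr_degree i)%:R / #|G|%:R * (y *+ (r == q)).
  rewrite -yrq mulr_sumr; apply: eq_bigr => g _.
  by rewrite mxE mul_mx_delta_mx mulrA.
rewrite -[y *+ _]mulr_natr mulrA [_ / _ * y]mulrAC trE [#|G|%:R * _]mulrC.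
rewrite mulfK ?card_group_neq0 //.
by rewrite -natrM mulnb eq_sym [r == q]eq_sym.
Qed.

Lemma irr_unit_irr0 (i j : sG) (s r : 'I_(irr_degree i)) :
  i != j -> \sum_g irr_unit s r g *: rho j g = 0.
Proof.
move=> nij; apply/matrixP => p q; rewrite summxE !mxE.
have := irr_intertwiner0 nij (mxsum_intertwiner (rho _) (rho _) (delta_mx s p)).
move/(congr1 (fun M : 'M_(_, _) => M r q)); rewrite summxE mxE => yrq.
have -> : \sum_g (irr_unit s r g *: rho j g) p q =
    (irr_degree i)%:R / #|G|%:R *
    \sum_g (rho i g^-1%g *m delta_mx s p *m rho j g) r q.
  rewrite mulr_sumr; apply: eq_bigr => g _.
  by rewrite mxE mul_mx_delta_mx mulrA.
by rewrite yrq mulr0.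
Qed.

(** In k[G] this reads g e_sr = sum_t rho(g)_ts e_tr, compared at the coefficient of h: the units
    with a fixed column r span a copy of the representation. *)
Lemma irr_unit_mul (i : sG) (s r : 'I_(irr_degree i)) (g h : G) :
  irr_unit s r (g^-1 * h)%g = \sum_t rho i g t s * irr_unit t r h.
Proof.
rewrite /irr_unit invMg invgK repr_mxM ?inE // mxE mulr_sumr.
by apply: eq_bigr => t _; rewrite mulrA mulrC.
Qed.

(** The diagonal units add up to 1. This is the decomposition of the regular character, evaluated at
    g^-1 and divided by |G|. *)
Lemma irr_unit_sum (g : G) :
  \sum_i \sum_(r < irr_degree i) irr_unit r r g = (g == 1%g)%:R.
Proof.
transitivity (#|G|%:R^-1 * \tr (regular_repr k [set: G] g^-1%g)).
  rewrite (mxtrace_regular_pchar sG pchar_pgroup) ?inE //; last first.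
    exact: (@group_closure_closed_field k G [set: G]%G).
  rewrite mulr_sumr; apply: eq_bigr => i _.
  rewrite -[\tr _ *+ _]mulr_natl mulrA [_^-1 * _]mulrC mulr_sumr.
  by [].
by rewrite mxtrace_regular_mx natrM mulKf ?card_group_neq0 // eq_invg1.
Qed.

End MatrixUnits.

(** * Dimension counts in vector spaces *)

Section LinearAlgebra.
Variable k : fieldType.

Definition subspace_closed (V : vectType k) (P : V -> Prop) : Prop :=
  P 0 /\ forall c u v, P u -> P v -> P (c *: u + v).

Lemma subspace_exists (V : vectType k) (P : V -> Prop) :
  subspace_closed P -> exists U : {vspace V}, forall v, v \in U <-> P v.
Proof.
move=> [P0 PD].
(* [P] is an arbitrary proposition, so a subspace inside it is enlarged by classically chosen
   vectors, one dimension at a time, until it exhausts [P] or fills V. *)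
have step m : (m <= \dim {:V})%N ->
    (exists U : {vspace V}, forall v, v \in U <-> P v) \/
    exists2 U : {vspace V}, \dim U = m & forall v, v \in U -> P v.
  elim: m => [_ | m IHm lt_m].
    by right; exists 0%VS => [|v]; rewrite ?dimv0 // memv0 => /eqP ->.
  have [|[U dimU UP]] := IHm (ltnW lt_m); first by left.
  have [UE | /existsNP[v]] := pselect (forall v, P v -> v \in U).
    by left; exists U => v; split; [exact: UP | exact: UE].
  move=> /not_implyP[Pv /negP vU]; right; exists (<[v]> + U)%VS.
    rewrite dimv_disjoint_sum ?dim_vline ?dimU.
      by case: eqP vU => // ->; rewrite mem0v.
    apply/eqP; rewrite -subv0; apply/subvP => w.
    rewrite memv_cap memv0 => /andP[/vlineP[c ->]].
    have [-> | c0] := eqVneq c 0; first by rewrite scale0r.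
    by move=> /(memvZ c^-1); rewrite scalerA mulVf // scale1r (negPf vU).
  by move=> _ /memv_addP[_ /vlineP[c ->] [u uU ->]]; apply: PD => //; exact: UP.
have [//|[U dimU UP]] := step _ (leqnn _); exists U => v.
split; first exact: UP.
have /eqP -> : U == fullv by rewrite eqEdim subvf dimU leqnn.
by rewrite memvf.
Qed.

(** The default [0%VS] is returned only if [P] does not cut out a subspace. *)
Definition subspace_of (V : vectType k) (P : V -> Prop) : {vspace V} :=
  xget 0%VS [set U : {vspace V} | forall v, v \in U <-> P v]%classic.

Lemma subspace_ofP (V : vectType k) (P : V -> Prop) v :
  subspace_closed P -> v \in subspace_of P <-> P v.
Proof.
move=> Pc; move: v; rewrite /subspace_of; case: xgetP => [U _ UP //|noU].
by have [U /noU] := subspace_exists Pc.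
Qed.

(** Rank-nullity for 0 -> A -> B -> C -> 0. The maps are bare functions and exactness is stated on
    elements, so that it applies directly to subspaces of Hom spaces and to maps such as [precomp]
    or the trace below. *)
Lemma dim_exact (U V W : vectType k) (A : {vspace U}) (B : {vspace V})
    (C : {vspace W}) (f : U -> V) (g : V -> W) :
  linear f -> linear g ->
  (forall u, u \in A -> f u = 0 -> u = 0) ->
  (forall w, w \in C <-> exists2 v, v \in B & g v = w) ->
  (forall v, v \in B /\ g v = 0 <-> exists2 u, u \in A & f u = v) ->
  \dim B = (\dim A + \dim C)%N.
Proof.
move=> flin glin finj gsurj fg.
pose f' := GRing.isLinear.Build _ _ _ _ f flin.
pose F := HB.pack_for {linear U -> V} f f'.
pose g' := GRing.isLinear.Build _ _ _ _ g glin.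
pose H := HB.pack_for {linear V -> W} g g'.
have -> : C = (linfun H @: B)%VS.
  apply/vspaceP => w; apply/idP/memv_imgP => [/gsurj[v vB <-] | [v vB ->]].
    by exists v; rewrite // lfunE.
  by apply/gsurj; exists v; rewrite // lfunE.
rewrite -(limg_ker_dim (linfun H) B); congr addn.
have -> : (B :&: lker (linfun H))%VS = (linfun F @: A)%VS.
  apply/vspaceP => v; apply/idP/memv_imgP => [|[u uA ->]].
    rewrite memv_cap memv_ker lfunE => /andP[vB /eqP gv].
    have /fg[u uA <-] : v \in B /\ g v = 0 by [].
    by exists u; rewrite ?lfunE.
  rewrite lfunE memv_cap memv_ker lfunE.
  by have [-> /= ->] : F u \in B /\ g (F u) = 0 by apply/fg; exists u.
apply: limg_dim_eq; apply/eqP; rewrite -subv0; apply/subvP => u.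
rewrite memv_cap memv_ker memv0 lfunE => /andP[uA /eqP fu].
by apply/eqP; apply: finj.
Qed.

Lemma dim_iso (V W : vectType k) (B : {vspace V}) (C : {vspace W}) (g : V -> W) :
  linear g ->
  (forall v, v \in B -> g v = 0 -> v = 0) ->
  (forall w, w \in C <-> exists2 v, v \in B & g v = w) ->
  \dim B = \dim C.
Proof.
move=> glin ginj gsurj.
rewrite (@dim_exact _ _ _ (0%VS : {vspace V}) B C idfun g) ?dimv0 // => v.
split=> [[vB gv] | [u]]; first by exists v; rewrite // memv0 (ginj v vB gv).
rewrite memv0 => /eqP -> <-; split; first exact: mem0v.
by have := glin (-1) 0 0; rewrite scaler0 addr0 scaleN1r addNr.
Qed.

Lemma linfunE (V W : vectType k) (f : V -> W) : linear f -> linfun f =1 f.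
Proof.
move=> flin; pose f' := GRing.isLinear.Build _ _ _ _ f flin.
by move=> v; rewrite (lfunE (HB.pack_for {linear V -> W} f f')).
Qed.

Lemma dim_lfun_into (V W : vectType k) (D : {vspace W}) (C : {vspace 'Hom(V, W)}) :
  (forall f, f \in C <-> forall v, f v \in D) ->
  \dim C = (\dim {:V} * \dim D)%N.
Proof.
move=> CP.
have -> : (\dim {:V} * \dim D = \dim {:'Hom(V, subvs_of D)})%N.
  by rewrite !dimvf.
symmetry; apply: (@dim_iso _ _ _ _ (fun h => linfun (@vsval _ _ D) \o h)%VF).
- by move=> c f h; rewrite comp_lfunDr comp_lfunZr.
- move=> h _ /lfunP h0; apply/lfunP => v; apply: subvs_inj.
  by have := h0 v; rewrite comp_lfunE lfunE !zero_lfunE linear0.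
move=> f; split=> [/CP fD | [h _ <-]].
  exists (linfun (vsproj D) \o f)%VF; first exact: memvf.
  by apply/lfunP => v; rewrite !comp_lfunE !lfunE /= vsprojK.
by apply/CP => v; rewrite comp_lfunE lfunE /= subvsP.
Qed.
End LinearAlgebra.

(** * Modules and Ext *)

Section RightModules.
Variables (k : fieldType) (B : falgType k).
Implicit Types (M N P : rmodule B) (a b : B).

Lemma rmod_actDl M (u v : M) a : rmod_act (u + v) a = rmod_act u a + rmod_act v a.
Proof. exact: linearD (@rmod_actl k B M a) u v. Qed.
Lemma rmod_actZl M c (v : M) a : rmod_act (c *: v) a = c *: rmod_act v a.
Proof. exact: linearZ_LR (@rmod_actl k B M a) c v. Qed.
Lemma rmod_act0l M a : rmod_act (0 : M) a = 0.
Proof. exact: linear0 (@rmod_actl k B M a). Qed.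

Lemma rHom_comp M N P f g :
  f \in rHom M N -> g \in rHom N P -> (g \o f)%VF \in rHom M P.
Proof.
by move=> /rHomP fH /rHomP gH; apply/rHomP => v a; rewrite !comp_lfunE fH gH.
Qed.

Lemma rHom_id M : \1%VF \in rHom M M.
Proof. by apply/rHomP => v a; rewrite !id_lfunE. Qed.

Lemma rmod_iso_sym M N : rmod_iso M N -> rmod_iso N M.
Proof. by move=> [f [g [fH gH gf fg]]]; exists g, f. Qed.

Lemma rmod_iso_trans M N P : rmod_iso M N -> rmod_iso N P -> rmod_iso M P.
Proof.
move=> [f [f' [fH f'H f'f ff']]] [g [g' [gH g'H g'g gg']]].
exists (g \o f)%VF, (f' \o g')%VF; split; try exact: rHom_comp.
  by rewrite comp_lfunA -[in LHS](comp_lfunA f') g'g comp_lfun1r.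
by rewrite comp_lfunA -[in LHS](comp_lfunA g) ff' comp_lfun1r.
Qed.

Lemma dim_rHom_iso_r M N P : rmod_iso N P -> \dim (rHom M N) = \dim (rHom M P).
Proof.
move=> [g [g' [gH g'H g'g gg']]].
apply: (@dim_iso _ _ _ _ _ (fun f => (g \o f)%VF)).
- by move=> c f h; rewrite comp_lfunDr comp_lfunZr.
- by move=> f _ gf; rewrite -[f]comp_lfun1l -g'g -comp_lfunA gf comp_lfun0r.
move=> f; split=> [fH | [h hH <-]]; last exact: rHom_comp.
by exists (g' \o f)%VF; [exact: rHom_comp | rewrite comp_lfunA gg' comp_lfun1l].
Qed.

Section Submodule.
Variables (M : rmodule B) (U : {vspace M}).
Hypothesis U_stable : forall v a, v \in U -> rmod_act v a \in U.

Definition rsub_act (v : subvs_of U) a : subvs_of U :=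
  vsproj U (rmod_act (vsval v) a).

Fact rsub_actE v a : vsval (rsub_act v a) = rmod_act (vsval v) a.
Proof. by rewrite vsprojK ?U_stable ?subvsP. Qed.
Fact rsub_act_linearl a : linear (rsub_act ^~ a).
Proof.
move=> c u v; apply: subvs_inj; rewrite linearP /= !rsub_actE linearP /=.
by rewrite rmod_actDl rmod_actZl.
Qed.
Fact rsub_act_linearr v : linear (rsub_act v).
Proof.
by move=> c a b; apply: subvs_inj; rewrite linearP /= !rsub_actE linearP.
Qed.
Fact rsub_act1 v : rsub_act v 1 = v.
Proof. by apply: subvs_inj; rewrite rsub_actE rmod_act1. Qed.
Fact rsub_actM v a b : rsub_act v (a * b) = rsub_act (rsub_act v a) b.
Proof. by apply: subvs_inj; rewrite !rsub_actE rmod_actM. Qed.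

Definition rsub : rmodule B :=
  RModule rsub_act_linearl rsub_act_linearr rsub_act1 rsub_actM.
End Submodule.

Definition rkernel M N (f : 'Hom(M, N)) (fH : f \in rHom M N) : rmodule B :=
  rsub (fun v a => @rker_stable k B M N f v a fH).

Lemma rkernel_actE M N (f : 'Hom(M, N)) (fH : f \in rHom M N) (v : rkernel fH) a :
  vsval (rmod_act v a) = rmod_act (vsval v) a.
Proof. by rewrite rsub_actE // => u b; exact: rker_stable. Qed.

(** With K the kernel of F0 -> M, this counts dimensions in 0 -> Hom(M, N) -> Hom(F0, N) -> Hom(K,
    N) -> Ext^1(M, N) -> 0. The additive form avoids truncated subtraction. *)
Lemma dim_ext1E M N :
  (dim_ext1 M N + \dim (rHom (res_F0 M) N) =
   \dim (rHom (rkernel (vbasis_map_rhom {:M})) N) + \dim (rHom M N))%N.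
Proof.
have [d0_onto im_d1 im_d2] := res_exact M.
have /rHomP d0H : res_d0 M \in rHom (res_F0 M) M by exact: vbasis_map_rhom.
have /rHomP d1H : res_d1 M \in rHom (res_F1 M) (res_F0 M) by exact: vbasis_map_rhom.
have d1d2 u : res_d1 M (res_d2 M u) = 0.
  by apply/eqP; rewrite -memv_ker -im_d2 memv_img ?memvf.
have d0d1 u : res_d0 M (res_d1 M u) = 0.
  by apply/eqP; rewrite -memv_ker -im_d1 memv_img ?memvf.
have -> : \dim (rHom (res_F0 M) N) =
    (\dim (rHom M N) + \dim (ext1_coboundaries M N))%N.
  apply: (@dim_exact _ _ _ _ _ _ _ (precomp (res_d0 M)) (precomp (res_d1 M)));
    try exact: precomp_linear.
  - move=> f _ fd0; apply/lfunP => v; rewrite zero_lfunE.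
    have /memv_imgP[u _ ->] : v \in limg (res_d0 M) by rewrite d0_onto memvf.
    by have /lfunP/(_ u) := fd0; rewrite comp_lfunE zero_lfunE.
  - move=> w; split=> [/memv_imgP[f fH ->] | [f fH <-]].
      by exists f; rewrite // lfunE.
    by apply/memv_imgP; exists f; rewrite // lfunE.
  move=> f; split=> [[fH fd1] | [g gH <-]]; last first.
    split; first by apply: rHom_comp gH; exact: vbasis_map_rhom.
    by apply/lfunP => u; rewrite !comp_lfunE d0d1 linear0 zero_lfunE.
  have fker u : res_d0 M u = 0 -> f u = 0.
    move=> /eqP; rewrite -memv_ker -im_d1 => /memv_imgP[w _ ->].
    by have /lfunP/(_ w) := fd1; rewrite comp_lfunE zero_lfunE.
  (* The inverse is only a k-linear section of d0, but [f] vanishes on ker d0, so the chosen lift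
     does not matter and the composite is B-linear. *)
  have fE u : f ((res_d0 M)^-1%VF (res_d0 M u)) = f u.
    apply/eqP; rewrite -subr_eq0 -linearB; apply/eqP/fker.
    by rewrite linearB /= limg_lfunVK ?subrr // memv_img ?memvf.
  exists (f \o (res_d0 M)^-1)%VF.
    apply/rHomP => v a.
    have /memv_imgP[u _ ->] : v \in limg (res_d0 M) by rewrite d0_onto memvf.
    by rewrite -d0H !comp_lfunE !fE; move/rHomP: fH.
  by apply/lfunP => u; rewrite !comp_lfunE fE.
rewrite addnCA [RHS]addnC /dim_ext1 subnK ?dimvS ?ext1_coboundaries_sub //.
congr addn.
(* Cocycles are the homomorphisms out of K: d1 maps F1 onto K, with kernel the image of d2. *)
set K := rkernel _; pose e : 'Hom(res_F1 M, K) :=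
  (linfun (vsproj (lker (res_d0 M))) \o res_d1 M)%VF.
have eE u : vsval (e u) = res_d1 M u.
  by rewrite comp_lfunE lfunE /= vsprojK // memv_ker d0d1.
have eH : e \in rHom (res_F1 M) K.
  by apply/rHomP => u a; apply: subvs_inj; rewrite rkernel_actE !eE d1H.
have e_onto w : exists u, w = e u.
  have /memv_imgP[u _ wE] : vsval w \in limg (res_d1 M) by rewrite im_d1 subvsP.
  by exists u; apply: subvs_inj; rewrite eE.
symmetry; apply: (@dim_iso _ _ _ _ _ (precomp e)); first exact: precomp_linear.
  move=> f _ fe; apply/lfunP => w; have [u ->] := e_onto w.
  by have /lfunP/(_ u) := fe; rewrite comp_lfunE !zero_lfunE.
move=> q; split=> [| [f fH <-]].
  rewrite memv_cap memv_ker lfunE => /andP[/rHomP qH /eqP/lfunP qd2].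
  have qker u : res_d1 M u = 0 -> q u = 0.
    move=> /eqP; rewrite -memv_ker -im_d2 => /memv_imgP[w _ ->].
    by have := qd2 w; rewrite comp_lfunE zero_lfunE.
  pose f : 'Hom(K, N) := (q \o (res_d1 M)^-1 \o linfun vsval)%VF.
  have fE u : f (e u) = q u.
    rewrite 2!comp_lfunE lfunE [X in _^-1%VF X]eE.
    apply/eqP; rewrite -subr_eq0 -linearB; apply/eqP/qker.
    by rewrite linearB /= limg_lfunVK ?subrr // memv_img ?memvf.
  exists f; last by apply/lfunP => u; rewrite comp_lfunE fE.
  apply/rHomP => w a; have [u ->] := e_onto w.
  by have /rHomP eH' := eH; rewrite -eH' !fE.
rewrite memv_cap rHom_comp //= memv_ker lfunE; apply/eqP/lfunP => u.
rewrite /= /precomp 2!comp_lfunE (_ : e _ = 0) ?linear0 ?zero_lfunE //.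
by apply: subvs_inj; rewrite eE d1d2 linear0.
Qed.
End RightModules.

(** * Ext into the one-dimensional module of an augmentation *)

Section Augmentation.
Variables (k : fieldType) (A : falgType k) (eps : {lrmorphism A -> k^o}).

Definition aug_act (c : k^o) (a : A) : k^o := eps a *: c.

Fact aug_act_linearl a : linear (aug_act ^~ a).
Proof. by move=> c u v; rewrite /aug_act scalerDr !scalerA mulrC. Qed.
Fact aug_act_linearr v : linear (aug_act v).
Proof. by move=> c a b; rewrite /aug_act linearP scalerDl scalerA. Qed.
Fact aug_act1 v : aug_act v 1 = v.
Proof. by rewrite /aug_act rmorph1 scale1r. Qed.
Fact aug_actM v a b : aug_act v (a * b) = aug_act (aug_act v a) b.
Proof. by rewrite /aug_act rmorphM scalerA mulrC. Qed.

Definition aug_module : rmodule A :=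
  RModule aug_act_linearl aug_act_linearr aug_act1 aug_actM.

Definition aug_trivial (M : rmodule A) : Prop :=
  forall (v : M) a, rmod_act v a = eps a *: v.

Definition aug_derivation (d : 'Hom(A, k^o)) : Prop :=
  forall a b, d (a * b) = eps b *: d a + eps a *: d b.

Lemma aug_derivation_closed : subspace_closed aug_derivation.
Proof.
split=> [a b | c d e dP eP a b]; first by rewrite !zero_lfunE !scaler0 addr0.
rewrite !add_lfunE !scale_lfunE dP eP !scalerDr !scalerA.
by rewrite ![c * _]mulrC addrACA.
Qed.

Variable D : {vspace 'Hom(A, k^o)}.
Hypothesis DP : forall d, d \in D <-> aug_derivation d.

Variables (X F M : rmodule A) (iota : 'Hom(X, F)) (pi : 'Hom(F, M)).
Hypotheses (iotaH : iota \in rHom X F) (piH : pi \in rHom F M).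
Hypotheses (iota_inj : lker iota = 0%VS) (pi_onto : limg pi = fullv).
Hypothesis exactF : limg iota = lker pi.
Hypothesis Mtriv : aug_trivial M.
(** Projectivity is given by a dual basis instead of taking [F] to be some [rfree]: a free A *
    G-module restricted to A is free, but not of that literal form. *)
Variables (I : finType) (e : I -> F) (c : I -> F -> A).
Hypotheses (c_lin : forall i, linear (c i))
  (cM : forall i x a, c i (rmod_act x a) = c i x * a)
  (dual_basis : forall x, x = \sum_i rmod_act (e i) (c i x)).

(* Count in two ways the functionals [p] on [F] whose restriction to [X] is
   A-linear: by restricting them to [X], and through the defect
   [p (x a) - eps a *: p x], which descends to a map from [M] to the derivations
   and is arbitrary because [F] is projective. *)
Lemma dim_aug_exact :
  (\dim (rHom X aug_module) + \dim {:M} =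
   \dim (rHom F aug_module) + \dim {:M} * \dim D)%N.
Proof.
have /rHomP iotaE := iotaH; have /rHomP piE := piH.
pose P (p : 'Hom(F, aug_module)) :=
  forall y a, p (iota (rmod_act y a)) = eps a *: p (iota y).
have [|T TP] := @subspace_exists _ _ P.
  split=> [y a | z p q pP qP y a]; first by rewrite !zero_lfunE scaler0.
  by rewrite !add_lfunE !scale_lfunE pP qP scalerDr !scalerA mulrC.
have pi0 y : pi (iota y) = 0.
  by apply/eqP; rewrite -memv_ker -exactF memv_img ?memvf.
pose s := (pi^-1)%VF.
have sK m : pi (s m) = m by rewrite limg_lfunVK // pi_onto memvf.
have kerE x : pi x = 0 -> exists y, x = iota y.
  move=> /eqP; rewrite -memv_ker -exactF => /memv_imgP[y _ ->]; by exists y.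
(* Restriction to X maps T onto Hom_A(X, k), by k-linear extension of functionals; its kernel is the
   space of all functionals on F/X = M. *)
have dimT1 : \dim T = (\dim {:M} + \dim (rHom X aug_module))%N.
  have -> : \dim {:M} = \dim {:'Hom(M, aug_module)}.
    by rewrite !dimvf [RHS]muln1.
  apply: (@dim_exact _ _ _ _ _ _ _ (precomp pi) (precomp iota));
    try exact: precomp_linear.
  - move=> f _ /lfunP fpi; apply/lfunP => m.
    by have := fpi (s m); rewrite comp_lfunE sK !zero_lfunE.
  - move=> f; split=> [/rHomP fH | [p /TP pP <-]]; last first.
      by apply/rHomP => y a; rewrite !comp_lfunE pP.
    have fE : (f \o iota^-1 \o iota)%VF = f.
      by rewrite -comp_lfunA lker0_compVf ?iota_inj ?comp_lfun1r.
    exists (f \o iota^-1)%VF; last exact: fE.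
    apply/TP => y a; have fE' z : (f \o iota^-1)%VF (iota z) = f z.
      by rewrite -[in RHS]fE [in RHS]comp_lfunE.
    by rewrite !fE' fH.
  move=> p; split=> [[pT /lfunP p0] | [f _ <-]]; last first.
    split; first by apply/TP => y a; rewrite !comp_lfunE !pi0 !linear0 ?scaler0.
    by apply/lfunP => y; rewrite !comp_lfunE pi0 linear0 zero_lfunE.
  exists (p \o s)%VF; first exact: memvf.
  apply/lfunP => x; rewrite !comp_lfunE; apply/eqP; rewrite -subr_eq0 -linearB.
  have [|y ->] := kerE (s (pi x) - x); first by rewrite linearB /= sK subrr.
  by have := p0 y; rewrite comp_lfunE zero_lfunE => py0; exact/eqP.
pose defect (p : 'Hom(F, aug_module)) x a := p (rmod_act x a) - eps a *: p x.
have defl p x : linear (defect p x).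
  move=> z a b; rewrite /defect !linearP /= scalerDl opprD addrACA.
  by rewrite scalerBr scalerA.
have defl2 p a : linear (defect p ^~ a).
  move=> z x y; rewrite /defect rmod_actDl rmod_actZl !linearP /=.
  by rewrite addrACA scalerDr.
have defl3 x a : linear (fun p => defect p x a).
  move=> z p q; rewrite /defect !add_lfunE !scale_lfunE.
  by rewrite scalerDr opprD addrACA scalerBr !scalerA mulrC.
pose Phi p : 'Hom(M, 'Hom(A, k^o)) := linfun (fun m => linfun (defect p (s m))).
have PhiE p m a : Phi p m a = defect p (s m) a.
  rewrite linfunE ?linfunE // => z m1 m2; apply/lfunP => b.
  by rewrite add_lfunE scale_lfunE !linfunE // linearP /= defl2.
(* Two lifts of the same element of M differ by an element of X, where [p] has zero defect. *)
have defT p x a : P p -> defect p x a = Phi p (pi x) a.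
  move=> pP; rewrite PhiE; apply/eqP; rewrite -subr_eq0.
  have := defl2 p a (-1) (s (pi x)) x; rewrite !scaleN1r addrC => <-.
  rewrite addrC; have [|y ->] := kerE (x - s (pi x)).
    by rewrite linearB /= sK subrr.
  by rewrite /defect -iotaE pP subrr.
have [|C CP] := @subspace_exists _ _
  (fun f : 'Hom(M, 'Hom(A, k^o)) => forall m, f m \in D).
  split=> [m | z f g fD gD m]; first by rewrite zero_lfunE mem0v.
  by rewrite add_lfunE scale_lfunE memvD ?memvZ.
suff dimT2 : \dim T = (\dim (rHom F aug_module) + \dim C)%N.
  by rewrite -(dim_lfun_into CP) -dimT2 dimT1 addnC.
apply: (@dim_exact _ _ _ _ _ _ _ id Phi) => //.
- move=> z p q; apply/lfunP => m; apply/lfunP => a.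
  by rewrite !(add_lfunE, scale_lfunE) !PhiE defl3.
- move=> f; split=> [/CP fD | [p /TP pP <-]]; last first.
    apply/CP => m; apply/DP => a b; rewrite !PhiE.
    (* Once M is known to be trivial, the last term becomes eps a times the defect at [b]: this is
       the derivation rule. *)
    have -> : defect p (s m) (a * b) =
        eps b *: defect p (s m) a + defect p (rmod_act (s m) a) b.
      rewrite /defect rmod_actM rmorphM scalerBr scalerA [RHS]addrC addrA.
      by rewrite subrK mulrC.
    congr (_ + _); rewrite !(defT p) // piE Mtriv linearZ /= scale_lfunE.
    by rewrite sK.
  have fder m a b := (DP _).1 (fD m) a b.
  have philin x : linear (fun p : 'Hom(F, aug_module) => p x).
    by move=> z p q; rewrite add_lfunE scale_lfunE.
  (* The functional sending e_i a to f(pi e_i)(a). By the derivation rule its defect at e_i c, in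
     the direction a, is eps(c) f(pi e_i)(a) = f(pi(e_i c))(a), as prescribed. *)
  pose p0 x : aug_module := \sum_i f (pi (e i)) (c i x).
  have p0lin : linear p0.
    move=> z x y; rewrite /p0 scaler_sumr -big_split /=; apply: eq_bigr => i _.
    by rewrite c_lin linearP.
  have p0E x a : p0 (rmod_act x a) - eps a *: p0 x = f (pi x) a.
    rewrite {3}(dual_basis x) scaler_sumr -sumrB !linear_sum sum_lfunE /=.
    apply: eq_bigr => i _.
    by rewrite cM fder addrAC subrr add0r piE Mtriv linearZ /= scale_lfunE.
  exists (linfun p0); last first.
    by apply/lfunP => m; apply/lfunP => a; rewrite PhiE /defect !linfunE // p0E sK.
  apply/TP => y a; rewrite !linfunE // iotaE.
  by apply/eqP; rewrite -subr_eq0 p0E pi0 linear0 zero_lfunE.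
move=> p; split=> [[/TP pP Phi0] | [q /rHomP qH <-]].
  exists p => //; apply/rHomP => x a; apply/eqP; rewrite -subr_eq0.
  by have := defT p x a pP; rewrite /defect Phi0 !zero_lfunE => ->.
split; first by apply/TP => y a; rewrite iotaE qH.
by apply/lfunP => m; apply/lfunP => a; rewrite PhiE /defect qH subrr !zero_lfunE.
Qed.
End Augmentation.

(** * Local algebras *)

Lemma lfun_eigenvector (k : closedFieldType) (V : vectType k) (f : 'End(V)) :
  {:V}%VS != 0%VS -> exists c v, v != 0 /\ f v = c *: v.
Proof.
move=> V0; pose M := lin1_mx (v2r \o f \o r2v).
have /closed_rootP[c] : size (char_poly M) != 1%N.
  by rewrite size_char_poly -dimvf eqSS dimv_eq0.
rewrite -eigenvalue_root_char => /eigenvalueP[v vM v0].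
exists c, (r2v v); split.
  by apply: contra v0 => /eqP/(congr1 v2r); rewrite r2vK linear0 => ->.
by apply: v2r_inj; rewrite linearZ /= r2vK -vM mul_rV_lin1.
Qed.

Section FalgUnit.
Variables (k : fieldType) (A : falgType k).

Lemma falg_unitP (u : A) : (forall v, u * v = 0 -> v = 0) -> u \is a GRing.unit.
Proof.
move=> u_inj; have uE v : amull u v = u * v by rewrite lfunE.
have ker0 : lker (amull u) == 0%VS.
  rewrite -subv0; apply/subvP => v; rewrite memv_ker uE memv0 => /eqP/u_inj ->.
  exact: eqxx.
have /memv_imgP[y _ uy] : 1 \in limg (amull u) by rewrite lker0_limgf ?memvf.
rewrite uE in uy; apply/unitrP; exists y; split=> //.
apply/eqP; rewrite -subr_eq0; apply/eqP/u_inj.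
by rewrite mulrBr mulrA -uy mul1r mulr1 subrr.
Qed.

Lemma falg_rinv_unit (u v : A) : u * v = 1 -> u \is a GRing.unit.
Proof.
move=> uv; have vU : v \is a GRing.unit.
  by apply: falg_unitP => w vw; rewrite -[w]mul1r -uv -mulrA vw mulr0.
by rewrite -[u]mulr1 -(mulrV vU) mulrA uv mul1r unitrV.
Qed.

Lemma right_ideal_sub_maximal (J : {vspace A}) :
  right_ideal J -> J <> fullv -> exists2 I, maximal_right_ideal I & (J <= I)%VS.
Proof.
have [n] := ubnP (\dim {:A} - \dim J); elim: n J => // n IHn J.
rewrite ltnS => le_n Jr Jf.
have [maxJ | ] := pselect (maximal_right_ideal J); first by exists J.
move=> nmax; have [J' [J'r sJ J'J J'f]] : exists J', [/\ right_ideal J',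
    (J <= J')%VS, J' <> J & J' <> fullv].
  apply: contrapT => H; apply: nmax; split=> // J' J'r sJ.
  by apply: contrapT => /not_orP[J'J J'f]; apply: H; exists J'.
have [|I Imax sI] := IHn J' _ J'r J'f; last by exists I; rewrite // (subv_trans sJ).
apply: leq_trans le_n; apply: ltn_sub2l.
  rewrite ltn_neqAle dimvS ?subvf // andbT; apply/eqP => dJ.
  by apply: Jf; apply/eqP; rewrite eqEdim subvf dJ leqnn.
rewrite ltn_neqAle dimvS // andbT; apply/eqP => dJ.
by apply: J'J; apply/eqP; rewrite eq_sym eqEdim sJ dJ leqnn.
Qed.
End FalgUnit.

(** The unique maximal right ideal I turns out to be two-sided and to be the set of nonunits. Left
    multiplication by a has an eigenvalue c, as k is algebraically closed; then a - c is not a unit,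
    so it lies in I, and eps a := c. *)
Lemma local_augmentation (k : closedFieldType) (A : falgType k) :
  local_algebra A -> exists eps : {lrmorphism A -> k^o},
    forall a, eps a != 0 -> a \is a GRing.unit.
Proof.
move=> [I [[Ir If _] Iuniq]].
have I1 : 1 \notin I.
  apply/negP => I1; apply: If; apply/vspaceP => a; rewrite memvf.
  by rewrite -[a]mul1r; apply: Ir.
have unitI x : x \in I -> x \isn't a GRing.unit.
  by move=> xI; apply/negP => Ux; case/negP: I1; rewrite -(mulrV Ux); apply: Ir.
have Iunit x : x \notin I -> x \is a GRing.unit.
  move=> xI; have [xA | xA] := pselect (limg (amull x) = fullv).
    have /memv_imgP[y _] : 1 \in limg (amull x) by rewrite xA memvf.
    by rewrite lfunE => /esym/falg_rinv_unit.
  have [|J Jmax sJ] := right_ideal_sub_maximal _ xA.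
    move=> _ a /memv_imgP[y _ ->]; rewrite lfunE /= -mulrA.
    by apply/memv_imgP; exists (y * a); rewrite ?memvf // lfunE.
  case/negP: xI; rewrite (Iuniq J Jmax); apply: (subvP sJ).
  by apply/memv_imgP; exists 1; rewrite ?memvf // lfunE /= mulr1.
have Il a x : x \in I -> a * x \in I.
  move=> xI; apply: contraT => /Iunit Uax.
  have yx : ((a * x)^-1 * a) * x = 1 by rewrite -mulrA mulVr.
  case/negP: (unitI _ xI); rewrite -[x]mul1r -(mulVr (falg_rinv_unit yx)).
  by rewrite -mulrA yx mulr1 unitrV (falg_rinv_unit yx).
have augI a : exists c : k, a - c *: 1 \in I.
  have [|c [v [v0 av]]] := lfun_eigenvector (amull a).
    by apply/eqP => A0; have := memvf (1 : A); rewrite A0 memv0 oner_eq0.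
  exists c; apply: contraT => /Iunit Uac; case/negP: v0.
  rewrite -[v]mul1r -(mulVr Uac) -mulrA mulrBl -scalerAl mul1r.
  by move: av; rewrite lfunE /= => ->; rewrite subrr mulr0.
have [eps epsI] := choice augI.
have epsE a c : a - c *: 1 \in I -> eps a = c.
  move=> aI; apply: contraNeq I1 => neq; rewrite -subr_eq0 in neq.
  rewrite -[1](scalerK neq) memvZ // scalerBl.
  by rewrite -opprB -[eps a *: 1](subKr a) opprB addrAC memvB // memvN.
have eps_lin : linear (eps : A -> k^o).
  move=> c a b; apply: epsE; rewrite scalerDl -scalerA opprD addrACA -scalerBr.
  by rewrite memvD ?memvZ.
have eps_mul : monoid_morphism (eps : A -> k^o).
  split=> [|a b]; apply: epsE; first by rewrite scale1r subrr mem0v.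
  have -> : a * b - (eps a * eps b) *: 1 =
      a * (b - eps b *: 1) + (a - eps a *: 1) * (eps b *: 1).
    rewrite mulrBr mulrBl addrA subrK; congr (_ - _).
    by rewrite -scalerAl -scalerAr mulr1 scalerA.
  by apply: memvD; [apply: Il | apply: Ir]; apply: epsI.
pose eps1 := GRing.isLinear.Build _ _ _ _ (eps : A -> k^o) eps_lin.
pose eps2 := GRing.isMonoidMorphism.Build _ _ (eps : A -> k^o) eps_mul.
exists (HB.pack_for {lrmorphism A -> k^o} (eps : A -> k^o) eps1 eps2) => a /= a0.
apply: Iunit; apply: contra a0 => aI; apply/eqP/epsE.
by rewrite scale0r subr0.
Qed.

Section LocalBricks.
Variables (k : fieldType) (A : falgType k) (eps : {lrmorphism A -> k^o}).
Hypothesis epsU : forall a, eps a != 0 -> a \is a GRing.unit.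

Lemma aug_ker_unit x : eps x = 0 -> 1 - x \is a GRing.unit.
Proof. by move=> x0; apply: epsU; rewrite linearB /= x0 rmorph1 subr0 oner_eq0. Qed.

(* An orbit [act v A] of minimal dimension among the nonzero ones: if [act v x]
   were nonzero for some [x] in the radical, its orbit would contain [v]. *)
Lemma aug_ker_annihilates (V : vectType k) (act : V -> A -> V) :
  {:V}%VS != 0%VS -> (forall v, linear (act v)) -> (forall v, act v 1 = v) ->
  (forall x a, eps x = 0 ->
     exists2 y, eps y = 0 & forall v, act (act v x) a = act v y) ->
  (forall x v, eps x = 0 -> act v x = v -> v = 0) ->
  exists2 v, v != 0 & forall a, act v a = eps a *: v.
Proof.
move=> V0 act_lin act1 actM act_fix.
suff [v v0 vI] : exists2 v, v != 0 & forall x, eps x = 0 -> act v x = 0.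
  exists v => // a; have := vI (a - eps a *: 1).
  rewrite linearB linearZ /= rmorph1 [_ *: _]mulr1 subrr => /(_ erefl).
  have := act_lin v (- eps a) 1 a; rewrite !scaleNr act1 [- _ + a]addrC => ->.
  by rewrite addrC => /eqP; rewrite subr_eq0 => /eqP.
pose orb v := limg (linfun (act v)).
have orbP v w : reflect (exists a, w = act v a) (w \in orb v).
  by apply: (iffP memv_imgP) => [[a _ ->] | [a ->]]; exists a; rewrite ?linfunE ?memvf.
have [v] : exists v : V, v != 0.
  by exists (vpick {:V}); rewrite vpick0.
have [n] := ubnP (\dim (orb v)); elim: n v => // n IHn v; rewrite ltnS => le_n v0.
have [vI | ] := pselect (forall x, eps x = 0 -> act v x = 0); first by exists v.
move=> /existsNP[x /not_implyP[x0 /eqP vx0]].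
apply: (IHn (act v x)) => //; apply: leq_trans le_n.
have sub : (orb (act v x) <= orb v)%VS.
  apply/subvP => w /orbP[a ->]; have [y _ ->] := actM x a x0.
  by apply/orbP; exists y.
rewrite ltn_neqAle dimvS // andbT; apply/eqP => dE.
have vorb : v \in orb (act v x).
  have /eqP -> : orb (act v x) == orb v by rewrite eqEdim sub dE leqnn.
  by apply/orbP; exists 1; rewrite act1.
case/orbP: vorb => a; have [y y0 ->] := actM x a x0.
by move=> /esym/(act_fix _ _ y0)/eqP; rewrite (negPf v0).
Qed.

(** The radical kills a nonzero vector [v] of S and a nonzero functional [xi] on S, so k is both a
    submodule and a quotient. The composite S -> k -> S is a nonzero endomorphism, hence invertible
    in a brick. *)
Lemma local_brick (S : rmodule A) : brick S -> rmod_iso S (aug_module eps).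
Proof.
move=> [S1 Sinv].
have S0 : {:S}%VS != 0%VS.
  apply: contra S1 => /eqP SE; apply/eqP/lfunP => v.
  by have := memvf v; rewrite SE memv0 => /eqP ->; rewrite !linear0.
have [||||v v0 vE] := @aug_ker_annihilates S (@rmod_act k A S) S0.
- exact: rmod_act_linearr.
- exact: rmod_act1.
- move=> x a x0; exists (x * a) => [|v]; last by rewrite rmod_actM.
  by rewrite rmorphM /= x0 mul0r.
- move=> x v x0 vx; have Ux := aug_ker_unit x0.
  rewrite -[v]rmod_act1 -(mulrV Ux) rmod_actM linearB /= rmod_act1 vx subrr.
  by rewrite rmod_act0l.
(* On the dual the order of multiplication is reversed. The annihilation lemma tolerates this, since
   it only asks that acting by [x] and then [a] be the action of some radical element. *)
pose dact (xi : 'Hom(S, k^o)) a := (xi \o linfun (@rmod_actl k A S a))%VF.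
have dactE xi a s : dact xi a s = xi (rmod_act s a).
  by rewrite comp_lfunE lfunE.
have [||||| xi xi0 xiE] := @aug_ker_annihilates _ dact.
- by rewrite -dimv_eq0 dimvf [dim _]muln1 -dimvf dimv_eq0.
- move=> xi c a b; apply/lfunP => s.
  by rewrite add_lfunE scale_lfunE !dactE !linearP.
- by move=> xi; apply/lfunP => s; rewrite dactE rmod_act1.
- move=> x a x0; exists (a * x) => [|xi]; first by rewrite rmorphM /= x0 mulr0.
  by apply/lfunP => s; rewrite !dactE rmod_actM.
- move=> x xi x0 /lfunP xix; apply/lfunP => s; have Ux := aug_ker_unit x0.
  rewrite -[s]rmod_act1 -(mulVr Ux) rmod_actM linearB /= rmod_act1 linearB /=.
  by rewrite -[X in _ - X]dactE xix subrr zero_lfunE.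
have xiH : (xi : 'Hom(S, aug_module eps)) \in rHom S (aug_module eps).
  by apply/rHomP => s a; rewrite -dactE xiE scale_lfunE.
have lin_v : linear (fun c : aug_module eps => (c : k) *: v).
  by move=> c a b; rewrite scalerDl scalerA.
pose G : 'Hom(aug_module eps, S) := linfun (fun c : aug_module eps => (c : k) *: v).
have GE c : G c = (c : k) *: v by rewrite linfunE.
have GH : G \in rHom (aug_module eps) S.
  by apply/rHomP => c a; rewrite !GE rmod_actZl vE !scalerA mulrC.
have xi_onto c : exists s, xi s = c.
  have /lfunPn[s] := xi0; rewrite zero_lfunE => xis.
  by exists ((c / xi s) *: s); rewrite linearZ /= [_ *: _]mulfVK.
have [||g gH [gf fg]] := Sinv (G \o xi)%VF; first exact: rHom_comp.
  have [s xis] := xi_onto 1; apply/lfunPn; exists s.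
  by rewrite comp_lfunE xis GE scale1r zero_lfunE.
exists xi, (g \o G)%VF; split=> //; first exact: rHom_comp.
  by rewrite -comp_lfunA.
apply/lfunP => c; have [s <-] := xi_onto c; rewrite id_lfunE.
have /lfunP/(_ s) := gf; rewrite id_lfunE => gfs.
by rewrite 2!comp_lfunE; move: gfs; rewrite 2!comp_lfunE => ->.
Qed.
End LocalBricks.

(** * Spectral radii and the dimension of a local algebra *)

Section RadiusBounds.
Variable R : realType.

Lemma normc_natr n : Normc.normc (n%:R : R[i]) = n%:R.
Proof.
have -> : (n%:R : R[i]) = (real_complex R n%:R) by rewrite rmorph_nat.
by rewrite /Normc.normc /= expr0n addr0 sqrtr_sqr normr_nat.
Qed.

Lemma spectral_radius0 (Q : 'M[nat]_0) : spectral_radius R Q = 0.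
Proof.
rewrite /spectral_radius [X in sup X](_ : _ = classical_sets.set0) ?sup0 //.
apply/seteqP; split=> // x [z /eigenvalueP[v _]] .
by rewrite (thinmx0 v) eqxx.
Qed.

Lemma spectral_radius1 (Q : 'M[nat]_1) : spectral_radius R Q = (Q 0 0)%:R.
Proof.
rewrite /spectral_radius -normc_natr.
rewrite [X in sup X](_ : _ = [set Normc.normc ((Q 0 0)%:R : R[i])]%classic) ?sup1 //.
apply/seteqP; split=> x.
  move=> [z /eigenvalueP[v vQ v0] <-] /=; congr Normc.normc.
  have v00 : v 0 0 != 0.
    by apply: contra v0 => /eqP v0; apply/eqP/rowP => i; rewrite !ord1 v0 mxE.
  have /rowP/(_ 0) := vQ; rewrite !mxE big_ord1 !mxE mulrC => /(mulIf v00).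
  by [].
move=> ->; exists (Q 0 0)%:R => //; apply/eigenvalueP; exists (const_mx 1).
  by apply/rowP => i; rewrite !mxE big_ord1 !mxE !ord1 mulrC.
by apply/eqP => /rowP/(_ 0)/eqP; rewrite !mxE oner_eq0.
Qed.

Lemma spectral_radius_ge n (Q : 'M[nat]_n) (v : 'I_n -> nat) (d : nat) :
  (exists i, v i != 0%N) ->
  (forall i, \sum_j Q i j * v j = d * v i)%N ->
  (d%:R <= spectral_radius R Q).
Proof.
move=> [i0 vi0] Qv; rewrite -normc_natr.
set Q' := map_mx (fun m => m%:R : R[i]) Q.
(* [eigenvalue] is about row vectors whereas [v] is a column eigenvector, so the argument is that Q'
   - d cannot be invertible. *)
have eigd : eigenvalue Q' d%:R.
  apply: contraT; rewrite /eigenvalue negbK /eigenspace kermx_eq0 row_free_unit.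
  move=> Qd; pose w : 'cV[R[i]]_n := \col_j (v j)%:R.
  have : (Q' - d%:R%:M) *m w = 0.
    rewrite mulmxBl mul_scalar_mx; apply/colP => i; rewrite !mxE.
    rewrite -natrM -Qv natr_sum; apply/eqP; rewrite subr_eq0; apply/eqP.
    by apply: eq_bigr => j _; rewrite !mxE natrM.
  move/(congr1 (mulmx (invmx (Q' - d%:R%:M)))); rewrite mulKmx // mulmx0.
  move/colP/(_ i0); rewrite !mxE => /eqP; rewrite pnatr_eq0.
  by rewrite (negPf vi0).
have memd : [set Normc.normc z | z in [set z : R[i] | eigenvalue Q' z]]%classic
    (Normc.normc (d%:R : R[i])) by exists d%:R.
apply: sup_upper_bound => //; split; first by exists (Normc.normc (d%:R : R[i])).
(* [sup] dominates only a set that is bounded above; the sum of the moduli of all characteristic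
   roots is a sufficient bound. *)
have [rs rsE] := closed_field_poly_normal (char_poly Q').
exists (\sum_(z <- rs) Normc.normc z) => _ [z /= zQ <-].
have zrs : z \in rs.
  move: zQ; rewrite eigenvalue_root_char rsE rootZ ?root_prod_XsubC //.
  by rewrite lead_coef_eq0 monic_neq0 ?char_poly_monic.
rewrite (big_rem z) //= lerDl sumr_ge0 // => -[a b] _; exact: sqrtr_ge0.
Qed.
End RadiusBounds.

(** * Ext into k over a local algebra *)

Section FreePresentation.
Variables (k : fieldType) (A : falgType k).

Definition rkernel_val (M N : rmodule A) (f : 'Hom(M, N)) (fH : f \in rHom M N) :
  'Hom(rkernel fH, M) := linfun (@vsval _ _ (lker f)).

Lemma rkernel_valE (M N : rmodule A) (f : 'Hom(M, N)) (fH : f \in rHom M N)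
  (v : rkernel fH) : rkernel_val fH v = vsval v.
Proof. by rewrite lfunE. Qed.

Lemma rkernel_val_rHom (M N : rmodule A) (f : 'Hom(M, N)) (fH : f \in rHom M N) :
  rkernel_val fH \in rHom (rkernel fH) M.
Proof. by apply/rHomP => v a; rewrite !rkernel_valE rkernel_actE. Qed.

Lemma rkernel_val_inj (M N : rmodule A) (f : 'Hom(M, N)) (fH : f \in rHom M N) :
  lker (rkernel_val fH) = 0%VS.
Proof.
apply/eqP/lker0P => u v; rewrite !rkernel_valE; exact: subvs_inj.
Qed.

Lemma limg_rkernel_val (M N : rmodule A) (f : 'Hom(M, N)) (fH : f \in rHom M N) :
  limg (rkernel_val fH) = lker f.
Proof.
apply/vspaceP => v; apply/memv_imgP/idP => [[u _ ->] | vK].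
  by rewrite rkernel_valE subvsP.
exists (vsproj (lker f) v); first exact: memvf.
by rewrite rkernel_valE vsprojK.
Qed.

Definition rfree_basis n (i : 'I_n) : rfree A n := [ffun j => (j == i)%:R].

Lemma rfree_basisE n (x : rfree A n) :
  x = \sum_i rmod_act (rfree_basis i) ((x : {ffun 'I_n -> A}) i).
Proof.
apply/ffunP => j; rewrite sum_ffunE (bigD1 j) //= big1 => [|i /negPf ij].
  by rewrite !ffunE eqxx mul1r addr0.
by rewrite !ffunE eq_sym ij mul0r.
Qed.
End FreePresentation.

Section LocalExt.
Variables (k : fieldType) (A : falgType k) (eps : {lrmorphism A -> k^o}).
Variable D : {vspace 'Hom(A, k^o)}.
Hypothesis DP : forall d, d \in D <-> aug_derivation eps d.

Lemma dim_rHom_aug (M : rmodule A) :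
  aug_trivial eps M -> \dim (rHom M (aug_module eps)) = \dim {:M}.
Proof.
move=> Mtriv; have -> : rHom M (aug_module eps) = fullv.
  apply/vspaceP => f; rewrite memvf; apply/rHomP => v a.
  by rewrite Mtriv linearZ.
by rewrite !dimvf [LHS]muln1.
Qed.

(** The two dimension formulas share the terms for Hom(K, k) and Hom(F0, k). As M is trivial, Hom(M,
    k) has dimension dim M, and cancelling leaves dim M * dim D. *)
Lemma dim_ext1_aug (M : rmodule A) :
  aug_trivial eps M -> dim_ext1 M (aug_module eps) = (\dim {:M} * \dim D)%N.
Proof.
move=> Mtriv; have [pi_onto _ _] := res_exact M.
have := @dim_aug_exact k A eps D DP _ _ _ _ _
  (rkernel_val_rHom (vbasis_map_rhom {:M})) (vbasis_map_rhom {:M})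
  (rkernel_val_inj _) pi_onto (limg_rkernel_val _) Mtriv _ (@rfree_basis k A _)
  (fun i x => (x : {ffun _ -> A}) i).
move=> /(_ _ _ (@rfree_basisE k A _)) dimE.
have := dim_ext1E M (aug_module eps); rewrite (dim_rHom_aug Mtriv) dimE.
  by rewrite addnC => /addnI.
- by move=> i c u v; rewrite !ffunE.
- by move=> i x a; rewrite ffunE.
Qed.

Lemma dim_ext1_iso_r (M N P : rmodule A) :
  rmod_iso N P -> dim_ext1 M N = dim_ext1 M P.
Proof.
move=> NP; apply: (@addIn (\dim (rHom (res_F0 M) N))).
rewrite dim_ext1E (dim_rHom_iso_r (rkernel _) NP) (dim_rHom_iso_r M NP).
by rewrite (dim_rHom_iso_r (res_F0 M) NP) dim_ext1E.
Qed.

Lemma aug_iso_trivial (M : rmodule A) :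
  rmod_iso M (aug_module eps) -> aug_trivial eps M /\ \dim {:M} = 1%N.
Proof.
move=> [f [g [/rHomP fH gH gf fg]]].
have fK v : g (f v) = v by have /lfunP/(_ v) := gf; rewrite comp_lfunE id_lfunE.
have gK v : f (g v) = v by have /lfunP/(_ v) := fg; rewrite comp_lfunE id_lfunE.
have triv : aug_trivial eps M.
  by move=> v a; rewrite -[LHS]fK fH -[in RHS](fK v) -linearZ.
split=> //; transitivity (\dim (fullv : {vspace k^o})); last by rewrite dimvf.
apply: (@dim_iso _ _ _ _ _ f) => [c u v | v _ fv | w].
- by rewrite linearP.
- by rewrite -[v]fK fv linear0.
by split=> _; rewrite ?memvf //; exists (g w); rewrite ?memvf ?gK.
Qed.
End LocalExt.

(** All bricks being isomorphic to k, a semibrick has at most one member, and the only nonempty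
    Ext-quiver is one vertex with dim D loops. *)
Lemma FPdim_local (R : realType) (k : fieldType) (A : falgType k)
    (eps : {lrmorphism A -> k^o}) (D : {vspace 'Hom(A, k^o)}) :
  (forall a, eps a != 0 -> a \is a GRing.unit) ->
  (forall d, d \in D <-> aug_derivation eps d) ->
  (FPdim R A <= ((\dim D)%:R : R)%:E)%E.
Proof.
move=> epsU DP; apply: ge_ereal_sup => _ [n [S [[Sbrick Siso _] ->]]].
rewrite lee_fin; have Saug i := local_brick epsU (Sbrick i).
case: n => [|[|n]] in S Sbrick Siso Saug *.
- by rewrite spectral_radius0 ler0n.
- rewrite spectral_radius1 mxE (dim_ext1_iso_r _ (Saug 0)).
  have [triv dim1] := aug_iso_trivial (Saug 0).
  by rewrite (dim_ext1_aug DP triv) dim1 mul1n.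
case: (Siso ord0 ord_max) => //.
exact: rmod_iso_trans (Saug _) (rmod_iso_sym (Saug _)).
Qed.

(** * Skew group algebras *)

Section SkewRestriction.
Variables (k : fieldType) (A : falgType k) (G : finGroupType) (act : algAction A G).
Notation AG := (skew_group act).

Lemma skew_elt_linear g : linear (fun a => skew_elt act a g).
Proof.
move=> c a b; apply/ffunP => x; rewrite !ffunE; case: eqP => // _.
by rewrite scaler0 addr0.
Qed.

Lemma skew_sumE I (r : seq I) (P : pred I) (F : I -> AG) x :
  ((\sum_(i <- r | P i) F i : AG) : {ffun G -> A}) x =
  \sum_(i <- r | P i) (F i : {ffun G -> A}) x.
Proof.
by apply: (big_morph (fun u : AG => (u : {ffun G -> A}) x)) => [u v|]; rewrite ffunE.
Qed.

Lemma skew_sum_elt (u : AG) :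
  u = \sum_g skew_elt act ((u : {ffun G -> A}) g) g.
Proof.
apply/ffunP => x; rewrite skew_sumE (bigD1 x) //= big1 ?addr0 => [|g gx].
  by rewrite ffunE eqxx.
by rewrite ffunE eq_sym (negPf gx).
Qed.

Section Restrict.
Variable X : rmodule AG.

Definition res_act (v : X) (a : A) : X := rmod_act v (skew_elt act a 1%g).

Fact res_act_linearl a : linear (res_act ^~ a).
Proof. by move=> c u v; rewrite /res_act rmod_actDl rmod_actZl. Qed.
Fact res_act_linearr v : linear (res_act v).
Proof. by move=> c a b; rewrite /res_act skew_elt_linear linearP. Qed.
Fact res_act1 v : res_act v 1 = v.
Proof. exact: rmod_act1. Qed.
Fact res_actM v a b : res_act v (a * b) = res_act (res_act v a) b.
Proof. by rewrite /res_act -rmod_actM skew_eltM alg_act1 mulg1. Qed.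

Definition res : rmodule A :=
  RModule res_act_linearl res_act_linearr res_act1 res_actM.
End Restrict.

(** Restriction keeps the underlying vector space, so the same linear map is merely retyped. *)
Lemma rHom_res (X Y : rmodule AG) (f : 'Hom(X, Y)) :
  f \in rHom X Y -> (f : 'Hom(res X, res Y)) \in rHom (res X) (res Y).
Proof. by move=> /rHomP fH; apply/rHomP => v a; exact: fH. Qed.

Lemma skew_mul_elt1 (u : AG) (a : A) g :
  ((u * skew_elt act a 1%g : AG) : {ffun G -> A}) g =
  (u : {ffun G -> A}) g * act g a.
Proof.
rewrite ffunE (bigD1 g) //= big1 ?addr0 => [|h hg].
  by rewrite ffunE mulVg eqxx.
by rewrite ffunE -eq_mulVg1 (negPf hg) rmorph0 mulr0.
Qed.

(* Since [a g = g (g^-1 a)], the group elements form a basis of the skew group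
   algebra as a right A-module, with coordinates twisted by [g^-1]. *)
Definition skew_basis n (p : 'I_n * G) : rfree AG n :=
  [ffun j => if j == p.1 then skew_elt act 1 p.2 else 0].

Definition skew_coord n (p : 'I_n * G) (x : rfree AG n) : A :=
  act p.2^-1%g (((x : {ffun 'I_n -> AG}) p.1 : {ffun G -> A}) p.2).

Lemma skew_coord_linear n (p : 'I_n * G) : linear (@skew_coord n p).
Proof. by move=> c u v; rewrite /skew_coord !ffunE linearP. Qed.

Lemma skew_coordM n (p : 'I_n * G) (x : rfree AG n) a :
  skew_coord p (rmod_act (x : res (rfree AG n)) a) = skew_coord p x * a.
Proof.
rewrite /skew_coord ffunE skew_mul_elt1 rmorphM /=.
by rewrite -alg_actM mulVg alg_act1.
Qed.

Lemma skew_basisE n (x : res (rfree AG n)) :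
  x = \sum_p rmod_act (skew_basis p : res (rfree AG n)) (skew_coord p x).
Proof.
apply/ffunP => j; rewrite sum_ffunE.
rewrite -(pair_bigA _ (fun i g =>
  rmod_act (skew_basis (i, g) : res (rfree AG n)) (skew_coord (i, g) x) j)) /=.
rewrite (bigD1 j) //= [X in _ + X]big1 ?addr0 => [|i /negPf ij]; last first.
  by apply: big1 => g _; rewrite !ffunE eq_sym ij mul0r.
rewrite [LHS]skew_sum_elt; apply: eq_bigr => g _.
by rewrite !ffunE eqxx skew_eltM mulg1 mul1r -alg_actM mulgV alg_act1.
Qed.

End SkewRestriction.

(** * Representations of G as modules over the skew group algebra *)

Section SkewRepresentation.
Variables (k : fieldType) (A : falgType k) (G : finGroupType) (act : algAction A G).
Notation AG := (skew_group act).
Variable eps : {lrmorphism A -> k^o}.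
Hypothesis eps_act : forall g a, eps (act g a) = eps a.

Definition skew_aug (u : AG) (g : G) : k := eps ((u : {ffun G -> A}) g).

(** Applying eps to coefficients is a ring map A * G -> k[G]: the twist in the skew product
    disappears under the G-invariant eps. *)
Lemma skew_augM u v h :
  skew_aug (u * v) h = \sum_g skew_aug u g * skew_aug v (g^-1 * h)%g.
Proof.
rewrite /skew_aug ffunE rmorph_sum; apply: eq_bigr => g _.
by rewrite rmorphM /= eps_act.
Qed.

Section OneRepresentation.
Variables (n : nat) (rG : mx_representation k [set: G] n).

Definition skew_mx (u : AG) : 'M[k]_n := \sum_g skew_aug u g *: rG g.

Fact skew_mx_linear : linear skew_mx.
Proof.
move=> c u v; rewrite /skew_mx scaler_sumr -big_split /=; apply: eq_bigr => g _.
by rewrite scalerA -scalerDl /skew_aug !ffunE linearP.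
Qed.

HB.instance Definition _ :=
  GRing.isLinear.Build k AG 'M[k]_n _ skew_mx skew_mx_linear.

Fact skew_mx_elt a g : skew_mx (skew_elt act a g) = eps a *: rG g.
Proof.
rewrite /skew_mx (bigD1 g) //= big1 ?addr0 => [|h /negPf hg].
  by rewrite /skew_aug ffunE eqxx.
by rewrite /skew_aug ffunE hg rmorph0 scale0r.
Qed.

Fact skew_mxM u v : skew_mx (u * v) = skew_mx u *m skew_mx v.
Proof.
rewrite mulmx_suml /skew_mx.
under eq_bigr do rewrite skew_augM scaler_suml.
rewrite exchange_big /=; apply: eq_bigr => g _.
rewrite mulmx_sumr (reindex_inj (mulgI g)); apply: eq_bigr => h _.
by rewrite mulKg repr_mxM ?inE // -scalemxAl -scalemxAr scalerA.
Qed.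

Definition rep_act (v : 'rV[k]_n) (u : AG) : 'rV[k]_n := v *m skew_mx u.

Fact rep_act_linearl u : linear (rep_act ^~ u).
Proof. by move=> c v w; rewrite /rep_act mulmxDl scalemxAl. Qed.
Fact rep_act_linearr v : linear (rep_act v).
Proof. by move=> c u w; rewrite /rep_act skew_mx_linear mulmxDr scalemxAr. Qed.
Fact rep_act1 v : rep_act v 1 = v.
Proof. by rewrite /rep_act skew_mx_elt rmorph1 scale1r repr_mx1 mulmx1. Qed.
Fact rep_actM v a b : rep_act v (a * b) = rep_act (rep_act v a) b.
Proof. by rewrite /rep_act skew_mxM mulmxA. Qed.

Definition rep_module : rmodule AG :=
  RModule rep_act_linearl rep_act_linearr rep_act1 rep_actM.

Lemma rep_module_trivial : aug_trivial eps (res rep_module).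
Proof.
move=> v a; rewrite -[LHS]/(v *m skew_mx _) skew_mx_elt repr_mx1.
by rewrite -scalemxAr mulmx1.
Qed.
End OneRepresentation.
End SkewRepresentation.

Section SkewIrreducibles.
Variables (k : closedFieldType) (A : falgType k) (G : finGroupType).
Variable act : algAction A G.
Notation AG := (skew_group act).
Variable eps : {lrmorphism A -> k^o}.
Hypothesis eps_act : forall g a, eps (act g a) = eps a.
Hypothesis charG : forall p : nat, p \in [pchar k] -> ~~ (p %| #|G|)%N.
Variable sG : irrType k [set: G].

Definition irr_module (i : sG) : rmodule AG := rep_module eps_act (irr_repr i).

Definition skew_unit (i : sG) (s r : 'I_(irr_degree i)) : AG :=
  [ffun g => irr_unit s r g *: 1].

Lemma skew_aug_unit i (s r : 'I_(irr_degree i)) g :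
  skew_aug eps (skew_unit s r) g = irr_unit s r g.
Proof. by rewrite /skew_aug ffunE linearZ rmorph1 [LHS]mulr1. Qed.

Lemma skew_mx_unit i (s r : 'I_(irr_degree i)) :
  skew_mx eps (irr_repr i) (skew_unit s r) = delta_mx s r.
Proof.
by rewrite -(irr_unit_irr charG); apply: eq_bigr => g _; rewrite skew_aug_unit.
Qed.

Lemma skew_mx_unit0 i j (s r : 'I_(irr_degree i)) :
  i != j -> skew_mx eps (irr_repr j) (skew_unit s r) = 0.
Proof.
move=> nij; rewrite -[RHS](irr_unit_irr0 charG s r nij).
by apply: eq_bigr => g _; rewrite skew_aug_unit.
Qed.

Lemma skew_unit_sum : \sum_i \sum_(r < irr_degree i) skew_unit r r = 1 :> AG.
Proof.
apply/ffunP => g; rewrite skew_sumE.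
under eq_bigr do rewrite skew_sumE.
under eq_bigr => i _ do under eq_bigr do rewrite ffunE.
under eq_bigr do rewrite -scaler_suml.
rewrite -scaler_suml irr_unit_sum // ffunE.
by case: eqP; rewrite (scale1r, scale0r).
Qed.

(** The element [u], the sum of the diagonal units of block i, acts as 1 on S_i and as 0 on S_j, so
    f v = f (v u) = (f v) u = 0. *)
Lemma irr_module_hom0 i j :
  i != j -> rHom (irr_module i) (irr_module j) = 0%VS.
Proof.
move=> nij; apply/eqP; rewrite -subv0; apply/subvP => f /rHomP fH.
rewrite memv0; apply/eqP/lfunP => v; rewrite zero_lfunE.
pose u := \sum_(r < irr_degree i) skew_unit r r : AG.
have uE j' : skew_mx eps (irr_repr j') u =
    \sum_(r < irr_degree i) skew_mx eps (irr_repr j') (skew_unit r r).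
  by rewrite linear_sum.
have := fH v u; rewrite /= /rep_act !uE.
under eq_bigr do rewrite skew_mx_unit.
under [in RHS]eq_bigr do rewrite skew_mx_unit0 //.
rewrite [in RHS]big1 // mulmx0 => <-; congr (f _).
rewrite -[LHS]mulmx1; congr (_ *m _); apply/matrixP => p q.
rewrite summxE !mxE (bigD1 p) //= big1 ?addr0 => [|r /negPf pr]; rewrite mxE.
  by rewrite eqxx eq_sym.
by rewrite eq_sym pr.
Qed.

(** The unit (o, s) carries the basis vector o to the basis vector s and kills the others, so the
    o-th coordinate of f(d_o) determines every f(d_s). *)
Lemma irr_module_scalar i f :
  f \in rHom (irr_module i) (irr_module i) -> exists c : k, f = c *: \1%VF.
Proof.
move=> /rHomP fH; pose o := Ordinal (irr_degree_gt0 i).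
pose d s : irr_module i := delta_mx 0 s.
exists (f (d o) 0 o); apply/lfunP => v; rewrite scale_lfunE id_lfunE.
have fd s : f (d s) = f (d o) 0 o *: d s.
  have := fH (d o) (skew_unit o s); rewrite /= /rep_act skew_mx_unit.
  rewrite mul_delta_mx => ->; apply/rowP => q.
  rewrite !mxE (bigD1 o) //= big1 ?addr0 => [|r /negPf ro]; rewrite mxE.
    by rewrite !eqxx.
  by rewrite ro mulr0.
rewrite (row_sum_delta v) linear_sum scaler_sumr; apply: eq_bigr => s _.
by rewrite linearZ /= [f _]fd !scalerA mulrC.
Qed.

Lemma irr_module_brick i : brick (irr_module i).
Proof.
have id0 : (\1%VF : 'End(irr_module i)) != 0.
  pose o := Ordinal (irr_degree_gt0 i).
  apply/eqP => /lfunP/(_ (delta_mx 0 o)); rewrite id_lfunE zero_lfunE.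
  by move/rowP/(_ o)/eqP; rewrite !mxE !eqxx oner_eq0.
split=> // f fH f0; have [c fE] := irr_module_scalar fH.
have c0 : c != 0 by apply: contra f0 => /eqP c0; rewrite fE c0 scale0r.
exists (c^-1 *: \1%VF); first by rewrite memvZ ?rHom_id.
rewrite fE; split; rewrite -comp_lfunZl -comp_lfunZr comp_lfun1l scalerA.
  by rewrite mulVf ?scale1r.
by rewrite mulfV ?scale1r.
Qed.

(** * Homomorphisms to the irreducibles and functionals over A *)

Section Multiplicities.
Variable X : rmodule AG.
Notation H := (rHom (res X) (aug_module eps)).

(** Rewriting a g as g (g^-1 a) puts the coefficient on the right, where the A-linear [lambda]
    extracts eps (g^-1 a) = eps a. *)
Lemma aug_hom_skew (lambda : 'Hom(X, k^o)) x w : lambda \in H ->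
  lambda (rmod_act x w) =
  \sum_g skew_aug eps w g *: lambda (rmod_act x (skew_elt act 1 g)).
Proof.
move=> /rHomP lH; rewrite {1}(skew_sum_elt w) !linear_sum; apply: eq_bigr => g _.
set a := (w : {ffun G -> A}) g.
have -> : skew_elt act a g = skew_elt act 1 g * skew_elt act (act g^-1%g a) 1%g.
  by rewrite skew_eltM mul1r mulg1 -alg_actM mulgV alg_act1.
by rewrite /= rmod_actM [LHS](lH _ _) /= /aug_act eps_act.
Qed.

(** The identity u e_sr = sum_t rho(u)_ts e_tr of k[G], valid here under [lambda], which sees
    elements of A * G only through [skew_aug]. *)
Lemma aug_hom_unit (lambda : 'Hom(X, k^o)) x u i (s r : 'I_(irr_degree i)) :
  lambda \in H ->
  lambda (rmod_act x (u * skew_unit s r)) =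
  \sum_t skew_mx eps (irr_repr i) u t s *: lambda (rmod_act x (skew_unit t r)).
Proof.
move=> lH; rewrite aug_hom_skew //.
under [RHS]eq_bigr do rewrite aug_hom_skew // scaler_sumr.
rewrite exchange_big /=; apply: eq_bigr => h _.
under [RHS]eq_bigr do rewrite scalerA skew_aug_unit.
rewrite -scaler_suml; congr (_ *: _).
rewrite skew_augM //.
under eq_bigr do rewrite skew_aug_unit irr_unit_mul mulr_sumr.
rewrite exchange_big; apply: eq_bigr => t _.
rewrite /skew_mx summxE mulr_suml; apply: eq_bigr => g _.
by rewrite [in RHS]mxE mulrA.
Qed.

(** A linear [f] with values in Hom(X, S_i) encodes n_i homomorphisms, one per basis vector. This
    trace plays the part of the adjunction of coinduction, restricted to block i. *)
Definition irr_trace_fun i (f : 'Hom('rV[k]_(irr_degree i), 'Hom(X, irr_module i)))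
  (x : X) : k^o := \sum_q f (delta_mx 0 q) x 0 q.

Definition irr_trace i (f : 'Hom('rV[k]_(irr_degree i), 'Hom(X, irr_module i))) :
  'Hom(X, k^o) := linfun (irr_trace_fun f).

Lemma irr_traceE i (f : 'Hom('rV[k]_(irr_degree i), 'Hom(X, irr_module i))) x :
  irr_trace f x = \sum_q f (delta_mx 0 q) x 0 q.
Proof.
rewrite linfunE // => c u v; rewrite /irr_trace_fun scaler_sumr -big_split /=.
by apply: eq_bigr => q _; rewrite linearP !mxE.
Qed.

Lemma irr_trace_linear i : linear (@irr_trace i).
Proof.
move=> c f g; apply/lfunP => x; rewrite add_lfunE scale_lfunE !irr_traceE.
rewrite scaler_sumr -big_split /=; apply: eq_bigr => q _.
by rewrite !(add_lfunE, scale_lfunE) !mxE.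
Qed.

Definition irr_copies i (f : 'Hom('rV[k]_(irr_degree i), 'Hom(X, irr_module i))) :=
  forall v, f v \in rHom X (irr_module i).

Lemma irr_trace_unit i f x j (s r : 'I_(irr_degree j)) : irr_copies f ->
  irr_trace f (rmod_act x (skew_unit s r)) =
  \sum_q (f (delta_mx 0 q) x *m skew_mx eps (irr_repr i) (skew_unit s r)) 0 q.
Proof.
move=> fC; rewrite irr_traceE; apply: eq_bigr => q _.
by have /rHomP -> := fC (delta_mx 0 q).
Qed.

(** The trace determines [f]: its value at x e_sr is the s-th coordinate of the r-th homomorphism at
    x. *)
Lemma irr_trace_unit_eq i f x (s r : 'I_(irr_degree i)) : irr_copies f ->
  irr_trace f (rmod_act x (skew_unit s r)) = f (delta_mx 0 r) x 0 s.
Proof.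
move=> fC; rewrite irr_trace_unit // (bigD1 r) //= big1 ?addr0 => [|q /negPf qr].
  rewrite skew_mx_unit mxE (bigD1 s) //= big1 ?addr0 => [|t /negPf ts].
    by rewrite mxE !eqxx mulr1.
  by rewrite mxE ts mulr0.
rewrite skew_mx_unit mxE big1 // => t _.
by rewrite mxE qr andbF mulr0.
Qed.

Lemma irr_trace_unit_neq i f x j (s r : 'I_(irr_degree j)) : irr_copies f ->
  j != i -> @irr_trace i f (rmod_act x (skew_unit s r)) = 0.
Proof.
move=> fC nji; rewrite irr_trace_unit // big1 // => q _.
by rewrite skew_mx_unit0 // mulmx0 mxE.
Qed.

Lemma irr_trace_aug i f : irr_copies f -> @irr_trace i f \in H.
Proof.
move=> fC; apply/rHomP => x a; rewrite -[rmod_act (_ : aug_module eps) _]/(eps a *: _).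
rewrite irr_traceE [irr_trace f x]irr_traceE.
rewrite scaler_sumr; apply: eq_bigr => q _.
have /rHomP fq := fC (delta_mx 0 q).
rewrite -[rmod_act x a]/(rmod_act (x : X) _) fq /= /rep_act skew_mx_elt.
by rewrite repr_mx1 -scalemxAr mulmx1 mxE.
Qed.

Lemma irr_trace_onto lambda i : lambda \in H ->
  exists2 f, irr_copies f &
    forall x, @irr_trace i f x =
      \sum_(r < irr_degree i) lambda (rmod_act x (skew_unit r r)).
Proof.
move=> lH.
(* This choice is forced: by [irr_trace_unit_eq], the r-th homomorphism must have lambda(x e_sr) as
   its s-th coordinate. *)
pose g (v : 'rV[k]_(irr_degree i)) (x : X) : irr_module i :=
  \row_s \sum_r v 0 r *: lambda (rmod_act x (skew_unit s r)).
have g_lin v : linear (g v).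
  move=> c x y; apply/rowP => s; rewrite !mxE mulr_sumr -big_split /=.
  apply: eq_bigr => r _; rewrite rmod_actDl rmod_actZl linearP scalerDr.
  by rewrite scalerA mulrC -scalerA.
have g_lin2 x : linear (g ^~ x).
  move=> c v w; apply/rowP => s; rewrite !mxE mulr_sumr -big_split /=.
  by apply: eq_bigr => r _; rewrite !mxE scalerDl -scalerA.
pose f : 'Hom('rV[k]_(irr_degree i), 'Hom(X, irr_module i)) :=
  linfun (fun v => linfun (g v)).
have fE v x : f v x = g v x.
  rewrite linfunE ?linfunE // => c u w; apply/lfunP => y.
  by rewrite add_lfunE scale_lfunE !linfunE // g_lin2.
exists f => [v | x].
  apply/rHomP => x u; rewrite !fE; apply/rowP => s.
  rewrite /= /rep_act mxE [RHS]mxE.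
  under eq_bigr do rewrite -rmod_actM aug_hom_unit // scaler_sumr.
  rewrite exchange_big /=; apply: eq_bigr => t _.
  rewrite mxE mulr_suml; apply: eq_bigr => r _.
  exact: etrans (mulrA _ _ _) (mulrAC _ _ _).
rewrite irr_traceE; apply: eq_bigr => q _; rewrite fE mxE.
rewrite (bigD1 q) //= big1 ?addr0 => [|r /negPf qr]; rewrite mxE eqxx.
  by rewrite eqxx scale1r.
by rewrite qr scale0r.
Qed.

(** The images T_i of the traces span H because 1 is the sum of the diagonal units. Their sum is
    direct because elements of T_j vanish at every x e_sr of a block i != j. Injectivity of the
    trace gives dim T_i = n_i dim Hom(X, S_i). *)
Lemma sum_dim_rHom_irr :
  (\sum_i irr_degree i * \dim (rHom X (irr_module i)) = \dim H)%N.
Proof.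
have copies_closed i : subspace_closed (@irr_copies i).
  split=> [v | c f g fC gC v]; first by rewrite zero_lfunE mem0v.
  rewrite add_lfunE scale_lfunE.
  by apply: memvD; [apply: memvZ; exact: fC | exact: gC].
pose C i := subspace_of (@irr_copies i).
have CP i f : f \in C i <-> irr_copies f by exact/subspace_ofP.
have tr0 i (f : 'Hom('rV[k]_(irr_degree i), 'Hom(X, irr_module i))) :
    irr_copies f ->
    (forall x (s r : 'I_(irr_degree i)),
       irr_trace f (rmod_act x (skew_unit s r)) = 0) ->
    f = 0.
  move=> fC f0; apply/lfunP => v; apply/lfunP => x; rewrite !zero_lfunE.
  rewrite (row_sum_delta v) linear_sum sum_lfunE big1 // => r _.
  rewrite linearZ scale_lfunE /= (_ : f _ x = 0) ?scaler0 //.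
  by apply/rowP => s; rewrite [RHS]mxE -[RHS](f0 x s r) irr_trace_unit_eq.
pose T i := subspace_of (fun l => exists2 f, f \in C i & irr_trace f = l).
have TP i l : l \in T i <-> exists2 f, f \in C i & irr_trace f = l.
  apply: subspace_ofP; split=> [|c _ _ [f fC <-] [g gC <-]].
    exists 0; first exact: mem0v.
    apply/lfunP => x; rewrite irr_traceE zero_lfunE big1 // => q _.
    by rewrite !zero_lfunE mxE.
  by exists (c *: f + g); rewrite ?memvD ?memvZ ?irr_trace_linear.
have dimT i : (irr_degree i * \dim (rHom X (irr_module i)))%N = \dim (T i).
  rewrite -(dim_iso (@irr_trace_linear i) _ (TP i)).
    rewrite (dim_lfun_into (CP i)); congr muln.
    by rewrite dimvf /dim /= mul1n.
  by move=> f /CP fC f0; apply: tr0 => // x s r; rewrite f0 zero_lfunE.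
have HT : H = (\sum_i T i)%VS.
  apply/vspaceP => l; apply/idP/idP => [lH | /memv_sumP[ls lsT ->]]; last first.
    apply: memv_suml => i _; have /TP[f /CP fC <-] := lsT i isT.
    exact: irr_trace_aug.
  have /choice[ls lsP] : forall i, exists m, m \in T i /\
      forall x, m x = \sum_(r < irr_degree i) l (rmod_act x (skew_unit r r)).
    move=> i; have [f fC fE] := irr_trace_onto i lH.
    by exists (irr_trace f); split=> //; apply/TP; exists f => //; apply/CP.
  have -> : l = \sum_i ls i.
    apply/lfunP => x; rewrite sum_lfunE.
    have {1}-> : x =
        \sum_i \sum_(r < irr_degree i) rmod_act (x : X) (skew_unit r r).
      rewrite -[LHS](rmod_act1 (x : X)) -skew_unit_sum linear_sum /=.
      by apply: eq_bigr => i _; rewrite linear_sum.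
    by rewrite linear_sum; apply: eq_bigr => i _; rewrite linear_sum (lsP i).2.
  by apply: memv_sumr => i _; exact: (lsP i).1.
rewrite HT; under eq_bigr do rewrite dimT.
symmetry; apply: (directvP _); apply/directv_sum_independent => ls lsT ls0 i _.
have /TP[f /CP fC fE] := lsT i isT; rewrite -fE (tr0 i f fC).
  apply/lfunP => x; rewrite irr_traceE zero_lfunE big1 // => q _.
  by rewrite !zero_lfunE mxE.
move=> x s r; have /lfunP/(_ (rmod_act x (skew_unit s r))) := ls0.
rewrite sum_lfunE zero_lfunE (bigD1 i) //= big1 ?addr0 => [|j ji].
  by rewrite -fE.
have /TP[h /CP hC <-] := lsT j isT.
by rewrite irr_trace_unit_neq // eq_sym.
Qed.
End Multiplicities.
End SkewIrreducibles.

(** * Ext between the irreducibles and the final comparison *)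

Section SkewExt.
Variables (k : closedFieldType) (A : falgType k) (G : finGroupType).
Variable act : algAction A G.
Variable eps : {lrmorphism A -> k^o}.
Hypothesis eps_act : forall g a, eps (act g a) = eps a.
Hypothesis charG : forall p : nat, p \in [pchar k] -> ~~ (p %| #|G|)%N.
Variable sG : irrType k [set: G].
Variable D : {vspace 'Hom(A, k^o)}.
Hypothesis DP : forall d, d \in D <-> aug_derivation eps d.
Notation S := (irr_module eps_act (sG := sG)).

(** Weighting [dim_ext1E] by n_j and summing over j turns each Hom over A * G into a Hom over A. The
    restricted sequence K -> F0 -> S_i then falls under [dim_aug_exact], with the group elements as
    dual basis. *)
Lemma sum_dim_ext1_irr (i : sG) :
  (\sum_j dim_ext1 (S i) (S j) * irr_degree j = \dim D * irr_degree i)%N.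
Proof.
set M := S i; have [pi_onto _ _] := res_exact M.
have Mtriv : aug_trivial eps (res M) by exact: rep_module_trivial.
have dimM : \dim {:M} = irr_degree i by rewrite dimvf /dim /= mul1n.
have := @dim_aug_exact k A eps D DP (res (rkernel (vbasis_map_rhom {:M})))
  (res (res_F0 M)) (res M) _ _
  (rHom_res (rkernel_val_rHom (vbasis_map_rhom {:M})))
  (rHom_res (vbasis_map_rhom {:M}))
  (rkernel_val_inj (vbasis_map_rhom {:M})) pi_onto
  (limg_rkernel_val (vbasis_map_rhom {:M})) Mtriv.
move=> /(_ _ (@skew_basis k A G act _) (@skew_coord k A G act _)).
move=> /(_ (@skew_coord_linear k A G act _) (@skew_coordM k A G act _)).
move=> /(_ (@skew_basisE k A G act _)).
rewrite -!(sum_dim_rHom_irr eps_act charG sG) => dimE.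
have extE : (\sum_j dim_ext1 M (S j) * irr_degree j +
    \sum_j irr_degree j * \dim (rHom (res_F0 M) (S j)) =
    \sum_j irr_degree j * \dim (rHom (rkernel (vbasis_map_rhom {:M})) (S j)) +
    \dim {:res M})%N.
  rewrite -[X in _ = (_ + X)%N](dim_rHom_aug Mtriv).
  rewrite -(sum_dim_rHom_irr eps_act charG sG).
  rewrite -!big_split /=; apply: eq_bigr => j _.
  by rewrite mulnC -!mulnDr dim_ext1E.
transitivity (\dim D * \dim {:res M})%N; last by rewrite dimM.
by move: extE; rewrite dimE addnC mulnC => /addnI.
Qed.
End SkewExt.

Theorem proposition4p3 (R : realType) (k : closedFieldType) (A : falgType k)
    (G : finGroupType) (act : algAction A G)
    (A_local : local_algebra A)
    (charG : forall p : nat, p \in [pchar k]%R -> ~~ (p %| #|G|)%N) :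
  (FPdim R A <= FPdim R (skew_group act))%E.
Proof.
have [eps epsU] := local_augmentation A_local.
have DP d : d \in subspace_of (aug_derivation eps) <-> aug_derivation eps d.
  by apply: subspace_ofP; exact: aug_derivation_closed.
(* Otherwise g(a) - eps a is a unit; applying g^-1 makes a - eps a a unit, although eps sends it to
   0. *)
have eps_act g a : eps (act g a) = eps a.
  apply/eqP; apply: contraT => neq.
  have := epsU (act g a - eps a *: 1); rewrite linearB linearZ /= rmorph1.
  rewrite [_ *: _]mulr1 subr_eq0 => /(_ neq)/(rmorph_unit (act g^-1%g)).
  rewrite rmorphB /= linearZ /= rmorph1 -alg_actM mulVg alg_act1.
  move/(rmorph_unit eps); rewrite rmorphB /= linearZ /= rmorph1.
  by rewrite [_ *: _]mulr1 subrr unitr0.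
pose sG : irrType k [set: G] := DecSocleType (regular_repr k [set: G]).
pose S (i : 'I_#|sG|) := irr_module eps_act (enum_val i : sG).
apply: le_trans (FPdim_local R epsU DP) _.
apply: (@le_trans _ _ (spectral_radius R (ext_quiver S))%:E); last first.
  apply: ereal_sup_ubound; exists #|sG|, S; split=> //.
  have Shom i j : i != j -> rHom (S i) (S j) = 0%VS.
    by move=> ij; apply: irr_module_hom0 => //; rewrite (inj_eq enum_val_inj).
  split=> // [i | i j ij]; first exact: irr_module_brick.
  move=> [f [g [fH _ gf _]]].
  have [id0 _] := irr_module_brick eps_act charG (enum_val i).
  move: fH id0; rewrite Shom // memv0 => /eqP f0.
  by rewrite -gf f0 comp_lfun0r eqxx.
rewrite lee_fin.
(* The degrees n_i form the eigenvector for d = dim D. The principal component only serves to show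
   that some entry is nonzero. *)
apply: (@spectral_radius_ge R _ _ (fun i => irr_degree (enum_val i))) => [|i].
  exists (enum_rank (principal_comp sG : sG)).
  by rewrite -lt0n irr_degree_gt0.
rewrite -(sum_dim_ext1_irr eps_act charG DP) [RHS]big_enum_val /=.
by apply: eq_bigr => j _; rewrite mxE.
Qed.
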